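(* Let $\kappa$ be an inaccessible cardinal and let $\chi<\kappa$ be an infinite cardinal. If there is a stationary subset of $E^\kappa_{\ge\chi}$ that does not reflect at any inaccessible cardinal, then $\mathrm{U}(\kappa,\kappa,\theta,\chi)$ holds for every infinite cardinal $\theta<\kappa$.
   Context: For a set $X$ and a cardinal $\nu$, $[X]^\nu$ is the set of subsets of $X$ of size $\nu$. For sets of ordinals $a,b$, $a<b$ means $\alpha<\beta$ for all $\alpha\in a,\beta\in b$. For a collection $\mathcal B$ of sets of ordinals, $(a,b)\in[\mathcal B]^2$ means that $a,b$ are distinct elements of $\mathcal B$ with $a<b$. For $c:[\kappa]^2\to\theta$ and $\alpha<\beta<\kappa$, $c(\alpha,\beta)$ denotes $c(\{\alpha,\beta\})$, and for $a<b$, $c[a\times b]=\{c(\alpha,\beta)\mid\alpha\in a,\beta\in b\}$. For a regular uncountable cardinal $\kappa$ and cardinals $\mu,\theta,\chi\le\kappa$, $\mathrm{U}(\kappa,\mu,\theta,\chi)$ asserts the existence of a coloring $c:[\kappa]^2\to\theta$ such that for every $\chi'<\chi$, every family $\mathcal A\subseteq[\kappa]^{\chi'}$ consisting of $\kappa$-many pairwise disjoint sets, and every $i<\theta$, there exists $\mathcal B\in[\mathcal A]^\mu$ such that $\min(c[a\times b])>i$ for all $(a,b)\in[\mathcal B]^2$. $E^\kappa_{\ge\chi}=\{\alpha<\kappa\mid\mathrm{cf}(\alpha)\ge\chi\}$. ''Inaccessible'' means weakly inaccessible, i.e., a regular uncountable limit cardinal. A set $S\subseteq\kappa$ does not reflect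 at any inaccessible cardinal if there is no inaccessible cardinal $\alpha<\kappa$ such that $S\cap\alpha$ is stationary in $\alpha$. *)

(* Defs.v *)
From mathcomp Require Import all_boot all_order.
From mathcomp Require Import boolp classical_sets functions cardinality wochoice.

Set Implicit Arguments.
Unset Strict Implicit.
Unset Printing Implicit Defensive.

Import Order.TTheory.
Local Open Scope order_scope.
Local Open Scope classical_set_scope.
Local Open Scope card_scope.

(* A well-ordered type [O] plays the part of (an initial
   segment of) the class of ordinals, and its elements are the ordinals; as [O]
   is arbitrary, every order type of an ordinal occurs as some [below k].  The
   von Neumann ordinal [a] = {x | x < a} is the set [below a]. *)
Definition below {d} {O : orderType d} (a : O) : set O := [set x | x < a].

(* cardinals are initial ordinals; this includes the finite ones *)
Definition cardinal {d} {O : orderType d} (a : O) : Prop :=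
  forall b : O, b < a -> ~ (below a #<= below b).

Definition infinite_cardinal {d} {O : orderType d} (a : O) : Prop :=
  cardinal a /\ infinite_set (below a).

(* [X]^nu *)
Definition subsets_of_size {d} {O : orderType d} {T : Type}
    (X : set T) (nu : O) : set (set T) :=
  [set A | A `<=` X /\ A #= below nu].

Definition cofinal {d} {O : orderType d} (a : O) (A : set O) : Prop :=
  A `<=` below a /\ forall b, b < a -> exists2 x, A x & b <= x.

(* The infimum is over a nonempty set ([below a] is cofinal in [a]), so in a
   well-order it is the least size of a cofinal subset; the default value is
   never used. *)
Definition cf {d} {O : orderType d} (a : O) : O :=
  infimum a [set nu | exists2 A : set O, cofinal a A & A #= below nu].

Definition regular {d} {O : orderType d} (k : O) : Prop :=
  infinite_cardinal k /\ cf k = k.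

Definition uncountable {d} {O : orderType d} (k : O) : Prop :=
  ~ countable (below k).

(* used for infinite cardinals only *)
Definition limit_cardinal {d} {O : orderType d} (k : O) : Prop :=
  cardinal k /\
  forall l : O, cardinal l -> l < k -> exists2 m : O, cardinal m & l < m < k.

(* i.e. weakly inaccessible *)
Definition inaccessible {d} {O : orderType d} (k : O) : Prop :=
  [/\ regular k, uncountable k & limit_cardinal k].

(* [sup (C \cap b) = b > 0] *)
Definition accumulation {d} {O : orderType d} (C : set O) (b : O) : Prop :=
  below b !=set0 /\ forall x, x < b -> exists2 y, C y & x < y < b.

Definition club {d} {O : orderType d} (k : O) (C : set O) : Prop :=
  cofinal k C /\ forall b, b < k -> accumulation C b -> C b.

Definition stationary {d} {O : orderType d} (k : O) (S : set O) : Prop :=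
  S `<=` below k /\ forall C, club k C -> S `&` C !=set0.

(* E^k_{>= chi} *)
Definition E_ge {d} {O : orderType d} (k chi : O) : set O :=
  [set a | a < k /\ chi <= cf a].

Definition no_inaccessible_reflection {d} {O : orderType d}
    (k : O) (S : set O) : Prop :=
  ~ exists a : O, [/\ inaccessible a, a < k & stationary a (S `&` below a)].

(* a < b for sets of ordinals *)
Definition set_lt {d} {O : orderType d} (a b : set O) : Prop :=
  forall x y, a x -> b y -> x < y.

(* A coloring c : [k]^2 -> theta is a binary function of which only the values
   [c x y] with [x < y < k] are meaningful. *)
Definition coloring {d} {O : orderType d} (k theta : O) (c : O -> O -> O) : Prop :=
  forall x y, x < y -> y < k -> c x y < theta.

(* U(k, mu, theta, chi), meant for k regular uncountable and cardinals
   mu, theta, chi <= k.  [min (c[a x b]) > i] is the inclusion at the end; the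
   image is empty only if [a] or [b] is, which cannot happen when the
   infinitely many members of [A] are equinumerous. *)
Definition U {d} {O : orderType d} (k mu theta chi : O) : Prop :=
  exists2 c : O -> O -> O, coloring k theta c &
  forall chi' : O, cardinal chi' -> chi' < chi ->
  forall A : set (set O),
    A `<=` subsets_of_size (below k) chi' ->
    A #= below k ->
    trivIset A id ->
  forall i : O, i < theta ->
  exists2 B : set (set O), subsets_of_size A mu B &
    forall a b : set O, B a -> B b -> a <> b -> set_lt a b ->
      [set c x y | x in a & y in b] `<=` [set z | i < z].

(* Main.v *)
(* Given sets C g cofinal in g, walk from x down to al, stepping from g to
   min (C g \ al).  The walk is finite; let c(al, x) be the largest value on it
   of a function h : kappa -> theta.  For c to witness U it suffices that, for all
   i < theta and all clubs E, there are y in E with h y > i and cf y >= chi, and a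
   member b of the family above y, such that for every x in b and al close enough
   to y the walk from x to al visits y (Fodor's lemma makes "close enough"
   uniform).  So the sets {h > i} have to be positive for a suitable notion of
   positivity, and such an h is read off the walks themselves.

   Restrict the given stationary set to uncountable limit cardinals.  If its
   regular members are stationary, or if its reflection points are not, then the
   C g can be chosen without accumulation points in some stationary subset T;
   walks then visit all y in T, and "positive" is "stationary on T".  Otherwise
   Fodor's lemma yields a stationary T of singulars of constant cofinality lam,
   whose reflection points are singular of cofinality other than lam.  If lam is
   uncountable, a club-guessing argument produces many y of large cofinality,
   just below points z of T, that are visited by every walk passing near z,
   provided that the C g are enlarged to hulls.  If lam is countable, the
   reflection points of T of some constant cofinality replace T. *)
Require Import Defs.
From mathcomp Require Import all_boot all_order.
From mathcomp Require Import boolp classical_sets functions cardinality wochoice.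

Set Implicit Arguments.
Unset Strict Implicit.
Unset Printing Implicit Defensive.

Import Order.TTheory.
Local Open Scope order_scope.
Local Open Scope classical_set_scope.
Local Open Scope card_scope.

(** * Cardinal arithmetic in a well-order *)

Class well_ordered {d} (O : orderType d) : Prop :=
  well_orderedP : well_order (<=%O : rel O).

Section Injections.
Context {T U : Type}.
Implicit Types (A : set T) (B : set U).

Lemma card_leI A B (f : T -> U) : (forall x, A x -> B (f x)) ->
  (forall x y, A x -> A y -> f x = f y -> x = y) -> A #<= B.
Proof.
move=> fAB finj; apply: (@card_le_trans _ _ _ (f @` A)).
  have : f @` A #= A by apply: inj_card_eq => x y /set_mem Ax /set_mem Ay; exact: finj.
  by rewrite card_eq_le => /andP[].
by apply: subset_card_le => _ [x Ax <-]; apply: fAB.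
Qed.

Lemma card_leE A B : U -> A #<= B -> exists f : T -> U,
  (forall x, A x -> B (f x)) /\
  (forall x y, A x -> A y -> f x = f y -> x = y).
Proof.
move=> u0 /card_leP[f].
pose g x := if pselect (A x) is left Ax
            then \val (f (SigSub (mem_set Ax))) else u0.
exists g; split=> [x Ax|x y Ax Ay]; rewrite /g.
  by case: pselect => // Ax'; exact: set_valP.
case: pselect => // Ax'; case: pselect => // Ay'.
move=> /val_inj e; have := @inj _ _ _ f _ _ (mem_set I) (mem_set I) e.
by case.
Qed.

Lemma card_eqW A B : A #= B -> A #<= B.
Proof. by rewrite card_eq_le => /andP[]. Qed.

Lemma card_eqV A B : A #= B -> B #<= A.
Proof. by rewrite card_eq_le => /andP[]. Qed.

Lemma card_le_empty A B : (forall x, ~ A x) -> A #<= B.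
Proof.
move=> A0; suff -> : A = set0 by exact: card_ge0.
by apply/seteqP; split=> x // /A0.
Qed.

Lemma card_leS A B (g : U -> T) :
  (forall x, A x -> exists2 y, B y & g y = x) -> A #<= B.
Proof.
move=> gA; apply: (@card_le_trans _ _ _ (g @` B)); last exact: card_image_le.
by apply: subset_card_le => x /gA[y By <-]; exists y.
Qed.
End Injections.

Section WellOrder.
Context {d : Order.disp_t} {O : orderType d} {Hwo : well_ordered O}.
Implicit Types (a b c x y z k : O) (A B X : set O).

Lemma ex_least A : A !=set0 -> exists m, A m /\ forall x, A x -> m <= x.
Proof.
case=> x Ax; have [|m [[mA lm] _]] := Hwo (A := mem A).
  by exists x; exact: mem_set.
exists m; split=> [|y Ay]; first exact: set_mem.
by apply: lm; exact: mem_set.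
Qed.

Lemma wo_lt_wf : well_founded (fun x y : O => x < y).
Proof.
move=> x; apply: contrapT => nAx.
have [m [nAm lem]] := @ex_least [set x | ~ Acc (fun x y : O => x < y) x]
  (ex_intro _ x nAx).
apply: nAm; constructor => y lt_ym; apply: contrapT => nAy.
by have := lem _ nAy; rewrite leNgt lt_ym.
Qed.

Lemma wo_ind (P : O -> Prop) :
  (forall x, (forall y, y < x -> P y) -> P x) -> forall x, P x.
Proof. by move=> IH x; elim: (wo_lt_wf x) => y _; exact: IH. Qed.

Definition least (o0 : O) A : O := xget o0 [set m | A m /\ forall x, A x -> m <= x].

Lemma leastP o0 A : A !=set0 -> A (least o0 A) /\ forall x, A x -> least o0 A <= x.
Proof.
move=> /ex_least[m Am]; rewrite /least.
by case: xgetP => [? -> //|/(_ m)]; case.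
Qed.

End WellOrder.

(** * Mostowski collapse and order types *)

Section Collapse.
Context {d : Order.disp_t} {O : orderType d} {Hwo : well_ordered O}.
Context {T : Type} (R : T -> T -> Prop) (Rwf : well_founded R).
Hypothesis Rtot : forall x y, [\/ R x y, x = y | R y x].
Variables (X : set T) (o0 : O).

(* The Mostowski collapse of [X]; the junk value [o0] is taken when no element of
   [O] is left. *)
Definition collapse : T -> O := Fix Rwf (fun=> O)
  (fun x rec => least o0 [set o | forall y (Ryx : R y x), X y -> rec y Ryx <> o]).

Lemma collapseE x :
  collapse x = least o0 [set o | forall y, R y x -> X y -> collapse y <> o].
Proof.
rewrite /collapse Fix_eq // => y f g fg.
congr least; apply/funext => o; apply/propext.
by split=> H z Rz Xz; [rewrite -fg|rewrite fg]; exact: H.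
Qed.

(** A value [o] not yet taken keeps [least] away from its junk value; by minimality all smaller
    ordinals are already taken. *)
Lemma collapse_spec x o : (forall y, R y x -> X y -> collapse y <> o) ->
  [/\ collapse x <= o, forall y, R y x -> X y -> collapse y <> collapse x
    & forall o, o < collapse x -> exists2 y, R y x /\ X y & collapse y = o].
Proof.
move=> No.
have [] := @leastP _ _ _ o0 [set o | forall y, R y x -> X y -> collapse y <> o].
  by exists o.
rewrite -collapseE => H1 H2; split; [exact: H2 | exact: H1 |].
move=> o' lt_o'; apply: contrapT => N2.
suff /H2 : forall y, R y x -> X y -> collapse y <> o' by rewrite leNgt lt_o'.
by move=> y Ry Xy yo; apply: N2; exists y.
Qed.

Variable t : O.
Hypothesis free : forall x, X x ->
  exists o, o < t /\ forall y, R y x -> X y -> collapse y <> o.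

Lemma collapse_lt x : X x -> collapse x < t.
Proof. by move=> /free[o [ot /collapse_spec[h _ _]]]; exact: le_lt_trans ot. Qed.

Lemma collapse_inj x y : X x -> X y -> collapse x = collapse y -> x = y.
Proof.
move=> Xx Xy e; case: (Rtot x y) => // Rxy.
  by have [o [_ /collapse_spec[_ /(_ _ Rxy Xx)]]] := free Xy.
by have [o [_ /collapse_spec[_ /(_ _ Rxy Xy)]]] := free Xx; rewrite e.
Qed.

(** The range of the collapse is an initial segment, and [b] is the least ordinal outside it. *)
Lemma collapse_eq : exists2 b, b <= t & X #= below b.
Proof.
have [|b [nb leb]] := @ex_least _ O _ (~` (collapse @` X)).
  by exists t => -[x /collapse_lt /[swap] ->]; rewrite ltxx.
exists b; first by apply: leb => -[x /collapse_lt /[swap] ->]; rewrite ltxx.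
have <- : collapse @` X = below b.
  rewrite /below; apply/seteqP; split=> [_ [x Xx <-]|o] /=; last first.
    by move=> ob; apply: contrapT => /leb; rewrite leNgt ob.
  rewrite ltNge; apply/negP; rewrite le_eqVlt => /orP[/eqP e|lt_b].
    by apply: nb; exists x.
  have [o [_ /collapse_spec[_ _ /(_ _ lt_b)[y [_ Xy] e]]]] := free Xx.
  by apply: nb; exists y.
rewrite card_eq_sym; apply: inj_card_eq => x y /set_mem Xx /set_mem Xy.
exact: collapse_inj.
Qed.

End Collapse.

(** * Squares and unions of infinite cardinals *)

Section Cardinals.
Context {d : Order.disp_t} {O : orderType d} {Hwo : well_ordered O}.
Implicit Types (a b c k t : O).

Lemma wo_tot (x y : O) : [\/ x < y, x = y | y < x].
Proof. by case: (ltgtP x y); [constructor 1|constructor 3|constructor 2]. Qed.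

Lemma below_sub a b : a <= b -> below a `<=` below b.
Proof. by move=> ab x /= /lt_le_trans; apply. Qed.

Lemma below_le a b : a <= b -> below a #<= below b.
Proof. by move=> ab; apply: subset_card_le; exact: below_sub. Qed.

Lemma sub_below_eq (A : set O) t : A `<=` below t -> exists2 b, b <= t & A #= below b.
Proof.
move=> At; apply: (@collapse_eq _ _ _ _ _ wo_lt_wf wo_tot A t) => x Ax.
(* The collapse of a set of ordinals never exceeds the identity, so [x] itself is still free at
   stage [x]. *)
exists x; split; first exact: At.
move=> y yx Ay; apply/eqP; rewrite lt_eqF//; apply: le_lt_trans yx.
elim/wo_ind: y Ay => y IH Ay.
have [] // := @collapse_spec _ _ _ _ _ wo_lt_wf A t y y.
by move=> z zy Az; apply/eqP; rewrite lt_eqF// (le_lt_trans _ zy)// IH.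
Qed.

Lemma card_le_below T (A : set T) t : A #<= below t ->
  exists2 b, b <= t & A #= below b.
Proof.
move=> /[dup] At /(card_leE t)[f [ft finj]].
have [|b bt e] := @sub_below_eq (f @` A) t; first by move=> _ [x /ft ? <-].
exists b => //; apply: card_eq_trans e; apply: card_esym.
by apply: inj_card_eq => x y /set_mem Ax /set_mem Ay; exact: finj.
Qed.

(* Compared first by maximum, so that an initial segment of
   [below t `*` below t] is bounded by a smaller square. *)
Definition goedel (p q : O * O) : Prop :=
  Order.max p.1 p.2 < Order.max q.1 q.2 \/
  (Order.max p.1 p.2 = Order.max q.1 q.2 /\
   (p.1 < q.1 \/ (p.1 = q.1 /\ p.2 < q.2))).

Lemma goedel_wf : well_founded goedel.
Proof.
suff H : forall m a b p, Order.max p.1 p.2 = m -> p.1 = a -> p.2 = b -> Acc goedel p.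
  by move=> p; exact: H.
elim/wo_ind => m IHm; elim/wo_ind => a IHa; elim/wo_ind => b IHb p pm pa pb.
constructor => q [|[e [|[e1]]]]; rewrite ?pm ?pa ?pb.
- by move=> /IHm; apply.
- by move=> /IHa; apply; rewrite // e pm.
- by move=> /IHb; apply; rewrite // ?e ?e1.
Qed.

Lemma goedel_tot p q : [\/ goedel p q, p = q | goedel q p].
Proof.
case: (ltgtP (Order.max p.1 p.2) (Order.max q.1 q.2)) => [h|h|e].
- by constructor 1; left.
- by constructor 3; left.
case: (ltgtP p.1 q.1) => [h|h|e1].
- by constructor 1; right; split=> //; left.
- by constructor 3; right; split=> //; left.
case: (ltgtP p.2 q.2) => [h|h|e2].
- by constructor 1; right; split=> //; right.
- by constructor 3; right; split=> //; right.
by constructor 2; move: e1 e2; case: p {e} => ? ?; case: q => ? ? /= -> ->.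
Qed.

Lemma cardX_le (A A' B B' : set O) :
  A #<= A' -> B #<= B' -> A `*` B #<= A' `*` B'.
Proof.
have [[x _]|A0] := pselect (A !=set0); last first.
  by move=> _ _; apply: card_le_empty => y [Ay _]; apply: A0; exists y.1.
move=> /(card_leE x)[f [fA fi]] /(card_leE x)[g [gB gi]].
apply: (card_leI (f := fun p => (f p.1, g p.2))) => [[p q] [/fA ? /gB ?]//|].
by move=> [p q] [p' q'] [Ap Bq] [Ap' Bq'] /= [/fi -> // /gi ->].
Qed.

Lemma infinite_two (A : set O) : infinite_set A -> exists x y, [/\ A x, A y & x <> y].
Proof.
move=> Ainf; have [x Ax] := infinite_setN0 Ainf; exists x.
apply: contrapT => N; apply: Ainf; apply: sub_finite_set (finite_set1 x) => y Ay.
by apply: contrapT => yx; apply: N; exists y; split=> // xy; apply: yx.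
Qed.

(** Induction on [t]. For a cardinal [t] the Goedel order on the square has type at most [t]: the
    predecessors of a pair with maximum [m] lie in the square of the ordinals up to [m], which is
    finite or, by induction, smaller than [t]. *)
Lemma hessenberg t : infinite_set (below t) -> below t `*` below t #<= below t.
Proof.
elim/wo_ind: t => t IH tinf.
have [tc|] := pselect (cardinal t); last first.
  move=> /existsNP[b /not_implyP[bt /contrapT tb]].
  have binf : infinite_set (below b).
    by move=> bf; apply: tinf; apply: card_le_finite tb bf.
  apply: card_le_trans (cardX_le tb tb) _.
  by apply: card_le_trans (IH _ bt binf) _; apply: below_le; exact: ltW.
have [x0 x0t] := infinite_setN0 tinf.
have [|b bt e] := @collapse_eq _ O _ _ _ goedel_wf goedel_tot
  (below t `*` below t) x0 t; last first.
- move: e; rewrite card_eq_le => /andP[e _]; apply: card_le_trans e _.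
  exact: below_le.
- move=> [p1 p2] [/= p1t p2t]; set m := Order.max p1 p2.
  have mt : m < t by rewrite /m gt_max p1t p2t.
  apply: contrapT => N.
  pose W : set O := [set y | y <= m].
  have tW : below t #<= W `*` W.
    apply: (@card_leS _ _ _ _ (collapse goedel_wf (below t `*` below t) x0)) => o ot.
    apply: contrapT => N2; apply: N; exists o; split=> // -[q1 q2] /= gq Xq qo.
    apply: N2; exists (q1, q2) => //.
    have : Order.max q1 q2 <= m by case: gq => [/ltW//|[-> //]].
    by rewrite ge_max => /andP[]; split.
  have Wm : W = m |` below m.
    apply/seteqP; split=> y; rewrite /W /= le_eqVlt.
      by case/orP => [/eqP ->|]; [left|right].
    by case=> [->|]; [rewrite eqxx|rewrite /below /= => ->; rewrite orbT].
  have [mf|minf] := pselect (finite_set (below m)).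
    apply: tinf; apply: card_le_finite tW _; apply: finite_setX; rewrite Wm;
    by rewrite finite_setU; split=> //; exact: finite_set1.
  apply: (tc _ mt).
  have mm := IH _ mt minf.
  have Wle : W #<= below m.
    have [y0 [y1 [y0m y1m y01]]] := infinite_two minf.
    apply: card_le_trans mm.
    (* The one extra element [m] is told apart by its second coordinate [y1]. *)
    apply: (card_leI (f := fun y => if y == m then (y0, y1) else (y, y0))).
      move=> y; rewrite Wm => -[->|ym]; first by rewrite eqxx.
      by case: eqP => // _; split.
    move=> y z; rewrite Wm => -[->|ym] -[->|zm]; rewrite ?eqxx //.
    - by case: eqP => // _ [_ /esym].
    - by case: eqP => // _ [_].
    - move: ym zm; rewrite /below /= => /lt_eqF -> /lt_eqF ->.
      by case.
  apply: card_le_trans tW _; apply: card_le_trans mm; exact: cardX_le.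
Qed.

Lemma card_bigcup_le (I T : Type) (D : set I) (F : I -> set T) t :
  infinite_set (below t) -> D #<= below t -> (forall i, D i -> F i #<= below t) ->
  \bigcup_(i in D) F i #<= below t.
Proof.
move=> tinf /(card_leE t)[f [fD fi]] DF.
apply: (@card_le_trans _ _ _ (below t `*` below t)); last exact: hessenberg.
have {}DF : forall i, exists g : T -> O, D i -> (forall x : T, F i x -> below t (g x)) /\
  (forall x y : T, F i x -> F i y -> g x = g y -> x = y).
  move=> i; have [Di|nD] := pselect (D i); last by exists (fun=> t).
  by have [g gP] := card_leE t (DF _ Di); exists g.
have [g gP] := choice DF.
have [[x0 [i0 Di0 Fx0]]|N] := pselect ((\bigcup_(i in D) F i) !=set0); last first.
  by apply: card_le_empty => x Fx; apply: N; exists x.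
have ch : forall x : T, exists i, (\bigcup_(i in D) F i) x -> D i /\ F i x.
  move=> x; have [[i Di Fx]|nF] := pselect ((\bigcup_(i in D) F i) x); first by exists i.
  by exists i0.
have [i iP] := choice ch.
apply: (card_leI (f := fun x : T => (f (i x), g (i x) x))).
  by move=> x /iP[Di Fx]; split => /=; [exact: fD|apply: (gP _ Di).1].
move=> x y /iP[Dx Fx] /iP[Dy Fy] [/(fi _ _ Dx Dy) e]; rewrite -e.
by apply: (gP _ Dx).2; rewrite // e.
Qed.

Lemma countable_le T (A : set T) t : infinite_set (below t) -> countable A -> A #<= below t.
Proof. by move=> /infiniteP tinf Ac; exact: card_le_trans Ac tinf. Qed.

Lemma finite_le T (A : set T) t : infinite_set (below t) -> finite_set A -> A #<= below t.
Proof. by move=> tinf /finite_set_countable; exact: countable_le. Qed.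

Lemma card_setU_le T (A B : set T) t : infinite_set (below t) ->
  A #<= below t -> B #<= below t -> A `|` B #<= below t.
Proof.
move=> tinf At Bt; rewrite -bigcup2E; apply: card_bigcup_le => //.
  by apply: countable_le => //; exact: card_leT.
by move=> [|[|n]] _ //=; exact: card_ge0.
Qed.

End Cardinals.

(** * Cofinality, clubs and stationary sets *)

Section Cofinality.
Context {d : Order.disp_t} {O : orderType d} {Hwo : well_ordered O}.
Implicit Types (a b c g k t x y z : O) (A B X S : set O).

Definition limit_ord g := below g !=set0 /\ forall x, x < g -> exists y, x < y < g.

(** The sizes of cofinal sets include [a], so they have a least element, and this is their only
    infimum. *)
Lemma cf_least a :
  (exists2 A, cofinal a A & A #= below (cf a)) /\
  (forall A t, cofinal a A -> A #= below t -> cf a <= t).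
Proof.
pose N := [set nu : O | exists2 A : set O, cofinal a A & A #= below nu].
have Na : N a by exists (below a); [split=> // b ba; exists b|].
have [m [Nm lem]] := @ex_least _ O _ N (ex_intro _ a Na).
have -> : cf a = m.
  rewrite /cf /infimum ifF; last first.
    by apply/negP => /eqP N0; have : set0 a by rewrite -N0.
  have im : infimums N m by split=> [x /lem//|x]; apply.
  case: xgetP => [x _ ix|/(_ m)//].
  exact: is_subset1_infimums ix im.
by split=> // A t Aa At; apply: lem; exists A.
Qed.

Lemma cf_min a A : cofinal a A -> below (cf a) #<= A.
Proof.
move=> Aa; have [b ba Ab] := sub_below_eq Aa.1.
exact: card_le_trans (below_le ((cf_least a).2 _ _ Aa Ab)) (card_eqV Ab).
Qed.

Lemma cf_le a : cf a <= a.
Proof.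
apply: ((cf_least a).2 (below a)); last exact: card_eqxx.
by split=> // b ba; exists b.
Qed.

Lemma cf_cardinal a : cardinal (cf a).
Proof.
move=> b ba H; have [[A Aa Acf] cfm] := cf_least a.
have [|b' b'b Ab'] := @card_le_below _ _ _ _ A b.
  exact: card_le_trans (card_eqW Acf) H.
by have := cfm _ _ Aa Ab'; rewrite leNgt (le_lt_trans b'b ba).
Qed.

Lemma not_cofinal_bounded g A : A `<=` below g -> ~ (below (cf g) #<= A) ->
  exists2 b, b < g & forall x, A x -> x < b.
Proof.
move=> Ag nA; apply: contrapT => N; apply: nA; apply: cf_min; split=> // b bg.
apply: contrapT => N2; apply: N; exists b => // x Ax; rewrite ltNge.
by apply/negP => bx; apply: N2; exists x.
Qed.

Lemma fun_bounded T (D : set T) (f : T -> O) g : (forall i, D i -> f i < g) ->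
  ~ (below (cf g) #<= D) -> exists2 b, b < g & forall i, D i -> f i < b.
Proof.
move=> fg nD; have [||b bg bP] := @not_cofinal_bounded g (f @` D).
- by move=> _ [i /fg ? <-].
- by move=> H; apply: nD; apply: card_le_trans H (card_image_le _ _).
- by exists b => // i Di; apply: bP; exists i.
Qed.

Lemma limit_finite_bounded g A : limit_ord g -> finite_set A -> A `<=` below g ->
  exists2 b, b < g & forall x, A x -> x < b.
Proof.
move=> [[x0 x0g] gl] /finite_seqP[s ->].
elim: s => [|y s IH] ys; first by exists x0.
have [|b bg bP] := IH; first by move=> x xs; apply: ys => /=; rewrite inE xs orbT.
have yg : y < g by apply: (ys y) => /=; rewrite inE eqxx.
have [|c /andP[mc cg]] := gl (Order.max y b); first by rewrite gt_max yg.
move: mc; rewrite gt_max => /andP[yc bc]; exists c => // x /=.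
rewrite inE => /orP[/eqP -> //|/bP /lt_trans]; exact.
Qed.

Lemma limit_cf_infinite g : limit_ord g -> infinite_set (below (cf g)).
Proof.
move=> gl fin; have [[A [Ag Ac] Acf] _] := cf_least g.
have [||b bg bP] := limit_finite_bounded gl (A := A) => //.
  exact: card_le_finite (card_eqW Acf) fin.
by have [x /bP] := Ac _ bg; rewrite ltNge => /negP.
Qed.

Lemma infinite_cardinal_limit t : infinite_cardinal t -> limit_ord t.
Proof.
move=> [tc tinf]; split; first exact: infinite_setN0.
move=> x xt; apply: contrapT => N.
have tE : below t `<=` [set x] `|` below x.
  move=> y yt; case: (ltgtP y x) => [yx|xy|->]; [by right| |by left].
  by exfalso; apply: N; exists y; rewrite xy.
have xinf : infinite_set (below x).
  move=> xf; apply: tinf; apply: sub_finite_set tE _.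
  by rewrite finite_setU; split=> //; exact: finite_set1.
apply: (tc _ xt); apply: card_le_trans (subset_card_le tE) _.
by apply: card_setU_le => //; apply: finite_le => //; exact: finite_set1.
Qed.

Lemma limit_infinite g : limit_ord g -> infinite_set (below g).
Proof.
move=> gl fin; have [b bg bP] := limit_finite_bounded gl fin (@subset_refl _ _).
by have := bP _ bg; rewrite ltxx.
Qed.

Lemma limit_regular g : limit_ord g -> cf g = g -> regular g.
Proof.
move=> gl e; split=> //; split; last exact: limit_infinite.
by rewrite -e; exact: cf_cardinal.
Qed.

Lemma club_tail g b : limit_ord g -> b < g -> club g [set x | b < x < g].
Proof.
move=> [g0 gl] bg; split.
  split=> [x /andP[]//|x xg].
  have [|y /andP[my yg]] := gl (Order.max b x); first by rewrite gt_max bg.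
  move: my; rewrite gt_max => /andP[byy xy].
  by exists y => /=; rewrite ?byy ?yg ?(ltW xy).
move=> c cg [[z zc] /(_ _ zc)[y /andP[lby _] /andP[_ yc]]] /=.
by rewrite cg (lt_trans lby yc).
Qed.

Lemma accumulation_sub A B b : A `<=` B -> accumulation A b -> accumulation B b.
Proof. by move=> AB [? H]; split=> // x /H[y /AB]; exists y. Qed.

Lemma accumulation_limit A b : accumulation A b -> limit_ord b.
Proof. by move=> [b0 bP]; split=> // x /bP[y _]; exists y. Qed.

Lemma club_accumulation g C : limit_ord g -> club g C -> accumulation C g.
Proof.
move=> [g0 gl] [[Cg Cc] _]; split=> // x /gl[y /andP[xy /Cc[z Cz yz]]].
by exists z; rewrite // (lt_le_trans xy yz) Cg.
Qed.

End Cofinality.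

(** * Clubs, stationary sets and Fodor's lemma at a regular uncountable cardinal *)

Section Clubs.
Context {d : Order.disp_t} {O : orderType d} {Hwo : well_ordered O}.
Implicit Types (a b c g t x y z : O) (A B X S C : set O).
Variable k : O.
Hypothesis kreg : regular k.
Hypothesis kunc : uncountable k.

Lemma regular_limit : limit_ord k.
Proof. by apply: infinite_cardinal_limit; case: kreg. Qed.

Lemma regular_bounded T (D : set T) (f : T -> O) : (forall i, D i -> f i < k) ->
  ~ (below k #<= D) -> exists2 b, b < k & forall i, D i -> f i < b.
Proof. by move=> fk nD; apply: fun_bounded => //; case: kreg => _ ->. Qed.

Lemma regular_bounded_below T (D : set T) (f : T -> O) t : t < k ->
  D #<= below t -> (forall i, D i -> f i < k) ->
  exists2 b, b < k & forall i, D i -> f i < b.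
Proof.
move=> tk Dt fk; apply: regular_bounded => // H.
by case: kreg => -[kc _] _; apply: (kc _ tk); exact: card_le_trans Dt.
Qed.

Lemma regular_bounded_nat (f : nat -> O) : (forall n, f n < k) ->
  exists2 b, b < k & forall n, f n < b.
Proof.
move=> fk; have [|//|b bk bP] := @regular_bounded _ [set: nat] f => //.
by exists b => // n; exact: bP.
Qed.

Lemma regular_bounded_le (f : O -> O) m : m < k -> (forall i, i < k -> f i < k) ->
  exists2 b, b < k & m < b /\ forall i, i <= m -> f i < b.
Proof.
move=> mk fk; have [_ /(_ _ mk)[m1 /andP[mm1 m1k]]] := regular_limit.
have [|||b bk bP] := @regular_bounded_below _ [set i | i <= m]
  (fun i => Order.max (f i) m) m1 => //.
- by apply: subset_card_le => i /= im; exact: le_lt_trans mm1.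
- by move=> i /= im; rewrite gt_max mk fk // (le_lt_trans im mk).
exists b => //; split=> [|i /bP]; last by rewrite gt_max => /andP[].
by have := bP m (lexx _); rewrite gt_max => /andP[].
Qed.

Lemma club_closure_points (f : O -> O) : (forall m, m < k -> f m < k) ->
  club k [set x | [/\ x < k, below x !=set0 & forall m, m < x -> f m < x]].
Proof.
move=> fk; split; last first.
  move=> b bk [b0 bP]; split=> // m /bP[y [_ _ yP] /andP[my yb]].
  exact: lt_trans (yP _ my) yb.
split=> [x []//|b bk].
have [g gP] : {g : O -> O | forall m, m < k ->
    [/\ g m < k, m < g m & forall i, i <= m -> f i < g m]}.
  apply: cid; have [|g gP] := @choice O O (fun m c => m < k ->
    [/\ c < k, m < c & forall i, i <= m -> f i < c]); last by exists g.
  move=> m; have [mk|] := pselect (m < k); last by exists m.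
  by have [c ck [mc cP]] := regular_bounded_le mk fk; exists c.
(* The supremum [x] of the iterates of [g] from [b] is closed under [f]; it stays below [k] because
   [k] is regular and uncountable. *)
pose u := fix u n := if n is n'.+1 then g (u n') else b.
have uk n : u n < k by elim: n => //= n /gP[].
have [e ek eP] := regular_bounded_nat uk.
have [x [xP lex]] := @ex_least _ O _ [set x | forall n, u n < x] (ex_intro _ e eP).
have xk : x < k by exact: le_lt_trans (lex _ eP) ek.
exists x; last exact: ltW (xP 0%N).
split=> //; first by exists (u 0%N); exact: xP.
move=> m mx; have [n mn] : exists n, m <= u n.
  apply: contrapT => N; have /lex : forall n, u n < m.
    by move=> n; rewrite ltNge; apply/negP => mn; apply: N; exists n.
  by rewrite leNgt mx.
by apply: lt_trans (xP n.+1) => /=; have [_ _] := gP _ (uk n); exact.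
Qed.

Lemma club_next C m : club k C -> m < k -> exists2 c, C c & m < c < k.
Proof.
by move=> /(club_accumulation regular_limit)[_]; exact.
Qed.

Lemma club_bigcap (I : Type) (C : I -> set O) : (forall i, club k (C i)) ->
  ~ (below k #<= [set: I]) -> club k [set x | x < k /\ forall i, C i x].
Proof.
move=> Cc nI; split; last first.
  move=> b bk bacc; split=> // i; apply: (Cc i).2 => //.
  by apply: accumulation_sub bacc => x [].
split=> [x []//|b bk].
have [f fP] : {f : O -> O | forall m, m < k ->
    f m < k /\ forall i, exists2 c, C i c & m < c < f m}.
  apply: cid; have [|g gP] := @choice O O (fun m e => m < k ->
    e < k /\ forall i, exists2 c, C i c & m < c < e); last by exists g.
  move=> m; have [mk|] := pselect (m < k); last by exists m.
  have [h hP] := @choice I O (fun i c => C i c /\ m < c < k) (fun i =>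
    let: ex_intro2 c Cc mc := club_next (Cc i) mk in ex_intro _ c (conj Cc mc)).
  have [||e ek eP] := @regular_bounded _ [set: I] h => //.
    by move=> i _; have [_ /andP[]] := hP i.
  exists e => _; split=> // i; have [Ch /andP[mh _]] := hP i.
  by exists (h i); rewrite // mh eP.
(* By the choice of [f], every [C i] accumulates at each closure point of [f]. *)
have [|[_ /(_ _ bk)[x [xk x0 xP] bx]] _] := @club_closure_points f.
  by move=> m /fP[].
exists x => //; split=> // i; apply: (Cc i).2 => //; split=> // m mx.
have [_ /(_ i)[c Cic /andP[mc cf]]] := fP _ (lt_trans mx xk).
by exists c; rewrite // mc (lt_trans cf) // xP.
Qed.

Lemma clubI C1 C2 : club k C1 -> club k C2 -> club k (C1 `&` C2).
Proof.
move=> C1c C2c; have := @club_bigcap bool (fun i => if i then C1 else C2).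
have -> : [set x | x < k /\ forall i : bool, (if i then C1 else C2) x] = C1 `&` C2.
  apply/seteqP; split=> x /=; first by case=> _ h; split; [exact: (h true)|exact: (h false)].
  by move=> [h1 h2]; split=> [|[]//]; exact: C1c.1.1.
apply; first by case.
move=> H; apply: kunc; apply: card_le_trans H _; exact: countableP.
Qed.

Lemma club_bigcap_nat (C : nat -> set O) : (forall n, club k (C n)) ->
  club k [set x | x < k /\ forall n, C n x].
Proof. by move=> Cc; apply: club_bigcap. Qed.

Lemma club_diag (C : O -> set O) : (forall i, i < k -> club k (C i)) ->
  club k [set x | [/\ x < k, below x !=set0 & forall i, i < x -> C i x]].
Proof.
move=> Cc; split; last first.
  move=> b bk [b0 bP]; split=> // i ib; apply: (Cc _ (lt_trans ib bk)).2 => //.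
  split=> // m mb; have [|y [_ _ yP]] := bP (Order.max i m); first by rewrite gt_max ib.
  by rewrite gt_max => /andP[/andP[iy my] yb]; exists y; rewrite ?my //; exact: yP.
split=> [x []//|b bk].
have [f fP] : {f : O -> O | forall m, m < k ->
    f m < k /\ forall i, i <= m -> exists2 c, C i c & m < c < f m}.
  apply: cid; have [|g gP] := @choice O O (fun m e => m < k ->
    e < k /\ forall i, i <= m -> exists2 c, C i c & m < c < e); last by exists g.
  move=> m; have [mk|] := pselect (m < k); last by exists m.
  have [|h hP] := @choice O O (fun i c => i < k -> C i c /\ m < c < k).
    move=> i; have [ik|] := pselect (i < k); last by exists m.
    by have [c Cic mc] := club_next (Cc _ ik) mk; exists c.
  have [|e ek [me eP]] := @regular_bounded_le h _ mk.
    by move=> i /hP[_ /andP[]].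
  exists e => _; split=> // i im.
  have [Ch /andP[mh _]] := hP _ (le_lt_trans im mk).
  by exists (h i); rewrite // mh eP.
have [|[_ /(_ _ bk)[x [xk x0 xP] bx]] _] := @club_closure_points f.
  by move=> m /fP[].
exists x => //; split=> // i ix; apply: (Cc _ (lt_trans ix xk)).2 => //; split=> // m mx.
have nx : Order.max i m < x by rewrite gt_max ix.
have [_ /(_ i)[|c Cic /andP[]]] := fP _ (lt_trans nx xk); first by rewrite le_max lexx.
rewrite gt_max => /andP[_ mc] cf.
by exists c; rewrite // mc (lt_trans cf) // xP.
Qed.

Lemma stationary_sub S S' : stationary k S -> S `<=` S' -> S' `<=` below k ->
  stationary k S'.
Proof. by move=> [_ H] SS' S'k; split=> // C /H[x [/SS' ? ?]]; exists x. Qed.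

Lemma stationaryI S C : stationary k S -> club k C -> stationary k (S `&` C).
Proof.
move=> [Sk H] Cc; split=> [x [/Sk]//|D Dc].
by have [x [Sx [Cx Dx]]] := H _ (clubI Cc Dc); exists x.
Qed.

Lemma not_stationary S : S `<=` below k -> ~ stationary k S ->
  exists2 C, club k C & forall x, S x -> ~ C x.
Proof.
move=> Sk N; apply: contrapT => N2; apply: N; split=> // C Cc.
apply: contrapT => N3; apply: N2; exists C => // x Sx Cx; apply: N3; by exists x.
Qed.

Lemma stationaryU S (P : O -> Prop) : stationary k S ->
  stationary k (S `&` [set x | P x]) \/ stationary k (S `&` [set x | ~ P x]).
Proof.
move=> Sst; have Sk := Sst.1; have [|N1] := pselect (stationary k (S `&` [set x | P x])).
  by left.
right; have [|C Cc CP] := not_stationary _ N1; first by move=> x [/Sk].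
apply: stationary_sub (stationaryI Sst Cc) _ _; last by move=> x [/Sk].
by move=> x [Sx Cx]; split=> // Px; apply: (CP x).
Qed.

Lemma stationary_next S b : stationary k S -> b < k -> exists2 x, S x & b < x < k.
Proof.
move=> [_ H] bk; have [x [Sx xb]] := H _ (club_tail regular_limit bk).
by exists x.
Qed.

Lemma stationary_card S : stationary k S -> below k #<= S.
Proof.
move=> Sst; have {1}<- : cf k = k by case: kreg.
apply: cf_min; split; first exact: Sst.1.
by move=> b /(stationary_next Sst)[x Sx /andP[bx _]]; exists x => //; exact: ltW.
Qed.

(** If every fibre of [f] missed a club [C c], a point [x] of [S] in the diagonal intersection would
    lie in [C (f x)] because [f x < x], although it belongs to that fibre. *)
Lemma fodor S (f : O -> O) : stationary k S -> (forall x, S x -> f x < x) ->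
  exists2 c, c < k & stationary k (S `&` [set x | f x = c]).
Proof.
move=> Sst fS; apply: contrapT => N.
have [|C CP] := @choice O (set O) (fun c C => c < k -> club k C /\
    forall x, S x -> f x = c -> ~ C x).
  move=> c; have [ck|] := pselect (c < k); last by exists set0.
  have [||C Cc CP] := @not_stationary (S `&` [set x | f x = c]).
  - by move=> x [/Sst.1].
  - by move=> Sc; apply: N; exists c.
  by exists C => _; split=> // x Sx fx; exact: CP.
have [x [Sx [xk _ xP]]] := Sst.2 _ (club_diag (fun i ik => (CP i ik).1)).
have fx := fS _ Sx.
by apply: ((CP _ (lt_trans fx xk)).2 _ Sx erefl); exact: xP.
Qed.

End Clubs.

(** * Walks *)

Section Walks.
Context {d : Order.disp_t} {O : orderType d} {Hwo : well_ordered O}.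
Implicit Types (a c e g t x y z w : O).
Variable N : O -> O -> set O.

(* [y] is on a walk from [x] towards [al]; every step may use another level [t] of
   the sets [N t x], which increase with [t]. *)
Inductive reach (al : O) : O -> O -> Prop :=
| reach_refl x : reach al x x
| reach_step t x z y : al < x -> N t x z -> al <= z ->
    (forall w, N t x w -> al <= w -> z <= w) -> reach al z y -> reach al x y.

Lemma reach_inv al x y : reach al x y -> y = x \/ exists t z,
  [/\ al < x, N t x z, al <= z, forall w, N t x w -> al <= w -> z <= w & reach al z y].
Proof. by case=> [?|t {}x z {}y *]; [left|right; exists t, z]. Qed.

Lemma reach_trans al x y z : reach al x y -> reach al y z -> reach al x z.
Proof. by elim=> // t {}x w {}y a b c e _ IH /IH; exact: reach_step a b c e. Qed.

Hypothesis N_lt : forall t g, N t g `<=` below g.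

Lemma reach_le al x y : reach al x y -> y <= x.
Proof. by elim=> // t {}x z {}y _ /N_lt zx _ _ _ /le_trans; apply; exact: ltW. Qed.

Hypothesis N_cof : forall t g al, al < g -> exists2 c, N t g c & al <= c.
Hypothesis N_mono : forall t t' g, t <= t' -> N t g `<=` N t' g.

(** Induction on a bound [v] of the values: from the first index where the value drops below [v],
    all values are at most that smaller one. *)
Lemma antitone_finite (f : O -> O) : (forall t t', t <= t' -> f t' <= f t) ->
  finite_set (range f).
Proof.
move=> fanti.
suff H : forall v, finite_set [set w | (range f) w /\ w <= v].
  have [[_ [t _ _]]|E] := pselect ((range f) !=set0); last first.
    by apply: sub_finite_set (finite_set0 _) => w fw; apply: E; exists w.
  have [m [_ lem]] := @ex_least _ O _ setT (ex_intro _ t I).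
  apply: sub_finite_set (H (f m)) => _ [s _ <-].
  by split; [exists s|apply: fanti; exact: lem].
elim/wo_ind => v IH.
have [[t ft]|nt] := pselect (exists t, f t < v); last first.
  apply: sub_finite_set (finite_set1 v) => w [[t _ <-]]; rewrite le_eqVlt.
  by case/orP => [/eqP //|ft]; exfalso; apply: nt; exists t.
have [t1 [ft1 let1]] := @ex_least _ O _ [set t | f t < v] (ex_intro _ t ft).
have : finite_set ([set v] `|` [set w | (range f) w /\ w <= f t1]).
  by rewrite finite_setU; split; [exact: finite_set1|exact: IH].
apply: sub_finite_set => w [[s _ <-]]; rewrite le_eqVlt.
case/orP => [/eqP //|fs]; [by left|right].
by split; [exists s|apply: fanti; exact: let1].
Qed.

(* [min (N t x \ al)] is antitone in [t], hence takes finitely many values. *)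
Lemma reach_finite al x : finite_set [set y | reach al x y].
Proof.
elim/wo_ind: x => x IH.
have [alx|xal] := ltP al x; last first.
  apply: sub_finite_set (finite_set1 x) => y /= /reach_inv[//|[t [z [alx _ _ _ _]]]].
  by move: xal; rewrite leNgt alx.
have [f fP] := @choice O O (fun t z => [/\ N t x z, al <= z &
    forall w, N t x w -> al <= w -> z <= w]) (fun t =>
  let: ex_intro2 c Nc alc := N_cof t alx in
  let: ex_intro z (conj (conj Nz alz) lez) :=
    @ex_least _ O _ [set z | N t x z /\ al <= z] (ex_intro _ c (conj Nc alc)) in
  ex_intro _ z (And3 Nz alz (fun w Nw alw => lez w (conj Nw alw)))).
have ff : finite_set (range f).
  apply: antitone_finite => t t' tt'; have [Nz alz _] := fP t.
  by have [_ _] := fP t'; apply => //; exact: N_mono Nz.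
have : finite_set ([set x] `|` \bigcup_(z in range f) [set y | reach al z y]).
  rewrite finite_setU; split; first exact: finite_set1.
  apply: bigcup_finite => // _ [t _ <-]; apply: IH.
  by have [/N_lt] := fP t.
apply: sub_finite_set => y /= /reach_inv[->|[t [z [_ Nz alz lez R]]]]; [by left|right].
exists z => //.
have [Nf alf lef] := fP t; exists t => //; apply/eqP; rewrite eq_le.
by rewrite lez // lef.
Qed.

Variables (h : O -> O) (th : O).
Hypothesis th_limit : limit_ord th.
Hypothesis h_lt : forall y, h y < th.

(** Different levels [t] give several walks, but by [reach_finite] they visit only finitely many
    points, so the bound stays below [th]. *)
Definition walk_color al x : O :=
  least th [set j | forall y, reach al x y -> h y <= j].

Lemma walk_colorP al x :
  walk_color al x < th /\ forall y, reach al x y -> h y <= walk_color al x.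
Proof.
have [||b bth bP] := limit_finite_bounded th_limit (A := h @` [set y | reach al x y]).
- by apply: finite_image; exact: reach_finite.
- by move=> _ [y _ <-]; exact: h_lt.
have bH : [set j | forall y, reach al x y -> h y <= j] b.
  by move=> y R; apply: ltW; apply: bP; exists y.
have [H1 H2] := leastP th (ex_intro _ b bH).
by split=> //; apply: le_lt_trans bth; exact: H2.
Qed.

Lemma cardinal_not_le T (D : set T) c c' t : cardinal c -> t < c -> c <= c' ->
  D #<= below t -> ~ (below c' #<= D).
Proof.
move=> cc tc cc' Dt H; apply: (cc _ tc).
exact: card_le_trans (below_le cc') (card_le_trans H Dt).
Qed.

Variables (k chi : O).
Hypothesis kreg : regular k.
Hypothesis kunc : uncountable k.
Hypothesis chi_card : cardinal chi.
Hypothesis chik : chi < k.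

(** The hits [y] form a stationary set, and Fodor's lemma makes the bound on [al] a constant [es].
    Thin out so that each chosen [b y] lies below the next hit. For hits [y < y'], a point of [b y]
    lies between [es] and [y'], so some walk towards it from [b y'] passes [y'], where [h] exceeds
    [i]. *)
Lemma U_of_hits :
  (forall chi', chi' < chi -> forall A : set (set O),
     A `<=` subsets_of_size (below k) chi' -> A #= below k -> trivIset A id ->
     forall i, i < th -> forall E, club k E ->
     exists y b, [/\ E y, chi <= cf y, i < h y &
       [/\ A b, forall x, b x -> y <= x &
       forall x, b x -> exists2 e, e < y & forall al, e < al -> al < y -> reach al x y]]) ->
  U k k th chi.
Proof.
move=> hits; exists walk_color; first by move=> x y _ _; have [] := walk_colorP x y.
move=> chi' _ chi'chi A Asub Ak Adisj i ith.
have ne b : A b -> b !=set0.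
  move=> Ab; apply: contrapT => b0.
  have bchi := (Asub _ Ab).2.
  have : finite_set A.
    apply: sub_finite_set (finite_set1 set0) => a Aa /=.
    apply/seteqP; split=> x // ax.
    have /(card_leE x)[f [fb _]] :=
      card_le_trans (card_eqW (Asub _ Aa).2) (card_eqV bchi).
    by apply: b0; exists (f x); exact: fb.
  move=> fA; have := limit_infinite (regular_limit kreg); apply.
  exact: card_le_finite (card_eqV Ak) fA.
pose Q y b := [/\ A b, forall x, b x -> y <= x &
  exists2 e, e < y & forall x al, b x -> e <= al -> al < y -> reach al x y].
pose T := [set y | [/\ y < k, i < h y & exists b, Q y b]].
have Tst : stationary k T.
  split=> [y []//|E Ec].
  have [y [b [Ey chiy iy [Ab by_ bP]]]] := hits _ chi'chi _ Asub Ak Adisj _ ith _ Ec.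
  exists y; split=> //; split=> //; first exact: Ec.1.1.
  exists b; split=> //.
  (* [b] has fewer than [chi <= cf y] elements, so their individual bounds have a common one below
     [y]. *)
  have [f fP] := @choice O O (fun x e => b x -> e < y /\
      forall al, e < al -> al < y -> reach al x y) (fun x =>
    match pselect (b x) with
    | left bx => let: ex_intro2 e ey eP := bP x bx in ex_intro _ e (fun=> conj ey eP)
    | right nbx => ex_intro _ x (fun bx => False_ind _ (nbx bx))
    end).
  have [||e ey eP] := @fun_bounded _ _ _ _ b f y.
  - by move=> x /fP[].
  - exact: cardinal_not_le chi_card chi'chi chiy (card_eqW (Asub _ Ab).2).
  exists e => // x al bx eal aly; apply: (fP _ bx).2 => //.
  exact: lt_le_trans (eP _ bx) eal.
have [b bP] := @choice O (set O) (fun y b => T y -> Q y b) (fun y =>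
    match pselect (T y) with
    | left (And3 _ _ H) => let: ex_intro b Qb := H in ex_intro _ b (fun=> Qb)
    | right nT => ex_intro _ set0 (fun Ty => False_ind _ (nT Ty))
    end).
have [e eP] := @choice O O (fun y e => T y -> e < y /\
    forall x al, b y x -> e <= al -> al < y -> reach al x y) (fun y =>
    match pselect (T y) with
    | left Ty => let: And3 _ _ (ex_intro2 e ey eP) := bP y Ty in ex_intro _ e (fun=> conj ey eP)
    | right nT => ex_intro _ y (fun Ty => False_ind _ (nT Ty))
    end).
have [es esk T1st] := fodor kreg kunc Tst (fun y Ty => (eP y Ty).1).
have [f fP] : {f : O -> O | forall y, y < k -> f y < k /\
    (T y -> forall x, b y x -> x < f y)}.
  apply: cid; have [|f fP] := @choice O O (fun y c => y < k -> c < k /\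
    (T y -> forall x, b y x -> x < c)); last by exists f.
  move=> y; have [Ty|nT] := pselect (T y); last by exists y.
  have [Ab _ _] := bP _ Ty; have [bk bchi] := Asub _ Ab.
  have [|c ck cP] := regular_bounded_below kreg (lt_trans chi'chi chik) (card_eqW bchi) (f := id).
    by move=> x /bk.
  by exists c.
have Cc := @club_closure_points _ _ Hwo _ kreg kunc _ (fun y yk => (fP y yk).1).
have T2st := @stationaryI _ _ Hwo _ kreg kunc _ _ T1st Cc.
set T2 := (X in stationary k X) in T2st.
have sep y y' x : T2 y -> T2 y' -> y < y' -> b y x -> x < y'.
  move=> [[Ty _] [yk _ _]] [_ [_ _ y'P]] yy' bx.
  exact: lt_trans ((fP _ yk).2 Ty _ bx) (y'P _ yy').
have sep2 y y' x x' : T2 y -> T2 y' -> y < y' -> b y x -> b y' x' -> x < x'.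
  move=> T2y T2y' yy' bx bx'; apply: lt_le_trans (sep _ _ _ T2y T2y' yy' bx) _.
  by have [[Ty' _] _] := T2y'; have [_ H _] := bP _ Ty'; exact: H.
have bne y : T2 y -> b y !=set0 by move=> [[/bP[/ne ? _ _] _] _].
have binj y y' : T2 y -> T2 y' -> b y = b y' -> y = y'.
  move=> T2y T2y' bb; case: (ltgtP y y') => // yy'.
    have [x bx] := bne _ T2y; have bx' := bx; rewrite bb in bx'.
    by have := sep2 _ _ _ _ T2y T2y' yy' bx bx'; rewrite ltxx.
  have [x bx] := bne _ T2y; have bx' := bx; rewrite bb in bx'.
  by have := sep2 _ _ _ _ T2y' T2y yy' bx' bx; rewrite ltxx.
exists (b @` T2); first split.
- by move=> _ [y [[Ty _] _] <-]; have [] := bP _ Ty.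
- apply: Cantor_Bernstein.
    apply: (@card_le_trans _ _ _ T2); [exact: card_image_le|apply: subset_card_le].
    exact: (proj1 T2st).
  apply: (@card_le_trans _ _ _ T2 _ _ (stationary_card kreg T2st)).
  apply: (card_leI (f := b)); last exact: binj.
  by move=> y T2y; exists y.
move=> _ _ [y T2y <-] [y' T2y' <-] bb lt_bb _ [al bal [x bx <-]] /=.
have yy' : y < y'.
  case: (ltgtP y y') => // [y'y|yy']; last by case: bb; rewrite yy'.
  have [w bw] := bne _ T2y; have [w' bw'] := bne _ T2y'.
  have := lt_trans (lt_bb _ _ bw bw') (sep2 _ _ _ _ T2y' T2y y'y bw' bw).
  by rewrite ltxx.
have [[Ty ey] _] := T2y; have [[Ty' ey'] _] := T2y'.
apply: lt_le_trans (let: And3 _ iy _ := Ty' in iy) _.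
apply: (walk_colorP al x).2; apply: (eP _ Ty').2 => //; last exact: sep bal.
rewrite ey' -ey; apply: le_trans (ltW (eP _ Ty).1) _.
by have [_ H _] := bP _ Ty; exact: H.
Qed.

End Walks.

(** * Splitting along walks *)

Section SuccessorCardinal.
Context {d : Order.disp_t} {O : orderType d} {Hwo : well_ordered O}.
Implicit Types (a b c g l t x y z : O) (A B X S : set O).

(** [nu] is the cardinal successor of [l]. Were it singular, it would be a union of at most [l] sets
    of size at most [l]. The limit property, applied to the cardinality [b] of [l], keeps it below
    [k]. *)
Lemma limit_cardinal_successor k l : limit_cardinal k -> l < k -> infinite_set (below l) ->
  exists nu, [/\ l < nu < k, regular nu, uncountable nu & ~ (below nu #<= below l)].
Proof.
move=> [kc klim] lk linf.
have [b [lb leb]] := @ex_least _ O _ [set b | below l #<= below b] (ex_intro _ l (card_lexx _)).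
have bl : b <= l by apply: leb; exact: card_lexx.
have bc : cardinal b.
  move=> e eb be; have := leb e (card_le_trans lb be); by rewrite leNgt eb.
have [m mc /andP[bm mk]] := klim _ bc (le_lt_trans bl lk).
have mW : ~ (below m #<= below l) by move=> ml; apply: (mc _ bm); exact: card_le_trans lb.
have [nu [nuW lenu]] := @ex_least _ O _ [set nu | ~ (below nu #<= below l)] (ex_intro _ m mW).
have lnu : l < nu by rewrite ltNge; apply/negP => /below_le.
have small e : e < nu -> below e #<= below l.
  by move=> enu; apply: contrapT => /lenu; rewrite leNgt enu.
have nuinf : infinite_set (below nu).
  by apply: sub_infinite_set linf; apply: below_sub; exact: ltW.
have nuc : cardinal nu.
  by move=> e /small el H; apply: nuW; exact: card_le_trans el.
have nul : limit_ord nu by exact: infinite_cardinal_limit.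
exists nu; rewrite lnu (le_lt_trans (lenu _ mW) mk); split=> //; last first.
  by move=> nucount; apply: nuW; exact: countable_le.
apply: limit_regular => //; apply: le_anti; rewrite cf_le /= leNgt; apply/negP => cfnu.
have [[A [Anu Acof] Acf] _] := cf_least nu.
apply: nuW; apply: (@card_le_trans _ _ _ (\bigcup_(a in A) [set x | x <= a])).
  by apply: subset_card_le => x /Acof[a Aa xa]; exists a.
apply: card_bigcup_le => //; first exact: card_le_trans (card_eqW Acf) (small _ cfnu).
move=> a /Anu anu; have [c /andP[ac cnu]] := nul.2 _ anu.
apply: card_le_trans (small _ cnu); apply: subset_card_le => x /= xa.
exact: le_lt_trans ac.
Qed.

End SuccessorCardinal.

(** * Where walks towards a point settle *)

Section Anchors.
Context {d : Order.disp_t} {O : orderType d} {Hwo : well_ordered O}.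
Implicit Types (a b c g l q t x y z : O) (A B X S : set O).

Variables (C : O -> set O) (k : O) (P : set O).
Hypothesis C_lt : forall g, C g `<=` below g.
Hypothesis C_cof : forall g al, al < g -> exists2 c, C g c & al <= c.
Hypothesis C_cl : forall g b, b < g -> accumulation (C g) b -> C g b.
Hypothesis C_card : forall g, C g #<= below (cf g).
Hypothesis C_P : forall g z, g < k -> P z -> z < g -> accumulation (C g) z ->
  forall c, C g c -> cf g <= c.
Hypothesis P_limit : forall z, P z -> limit_ord z.

(* The walk from [x] gets to [z], or at least to some [g] for which [z] is one of few
   accumulation points of [C g]. *)
Definition anchored x z q := exists g, [/\ z <= g,
  forall al, q <= al -> al <= z -> reach (fun=> C) al x g &
  g = z \/ [/\ z < g, accumulation (C g) z & C g #<= below q]].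

Lemma anchored_mono x z q q' : q <= q' -> anchored x z q -> anchored x z q'.
Proof.
move=> qq' [g [zg R H]]; exists g; split=> //.
  by move=> al q'al; apply: R; exact: le_trans q'al.
case: H => [|[h1 h2 h3]]; [by left|right]; split=> //.
exact: card_le_trans h3 (below_le qq').
Qed.

(** Induction along the walk. If [C x] accumulates at [z], take [g = x] and some [q] in [C x] below
    [z]; then [cf x <= q] by [C_P]. Otherwise [C x] is bounded below [z], so for [al] close to [z]
    the next step is the one towards [z]. *)
Lemma anchored_ex x z : P z -> z <= x -> x < k -> exists2 q, q < z & anchored x z q.
Proof.
move=> Pz; elim/wo_ind: x => x IH; rewrite le_eqVlt => /orP[/eqP <- _|zx xk].
  have [[q qz] _] := P_limit Pz; exists q => //; exists z; split=> //; last by left.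
  by move=> al _ _; exact: reach_refl.
have [ac|nac] := pselect (accumulation (C x) z).
  have [[q0 q0z] /(_ _ q0z)[c Cc /andP[_ cz]]] := ac.
  exists c => //; exists x; split; first exact: ltW.
    by move=> al _ _; exact: reach_refl.
  right; split=> //; apply: card_le_trans (C_card x) _; apply: below_le.
  exact: (C_P xk Pz).
have [[z0 z0z] zl] := P_limit Pz.
have [q0 [q0z q0P]] : exists q0, q0 < z /\ forall y, C x y -> y < z -> y <= q0.
  apply: contrapT => N; apply: nac; split; first by exists z0.
  move=> w wz; apply: contrapT => N2; apply: N; exists w; split=> // y Cy yz.
  by rewrite leNgt; apply/negP => wy; apply: N2; exists y; rewrite // wy.
have [c0 Cc0 zc0] := C_cof zx.
have [x' [[Cx' zx'] lex']] := @ex_least _ O _ [set c | C x c /\ z <= c]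
  (ex_intro _ c0 (conj Cc0 zc0)).
have x'x : x' < x by exact: C_lt.
have [q1 q1z [g [zg R H]]] := IH _ x'x zx' (lt_trans x'x xk).
have [|q /andP[]] := zl (Order.max q0 q1); first by rewrite gt_max q0z.
rewrite gt_max => /andP[q0q q1q] qz.
exists q => //; exists g; split=> //.
  move=> al qal alz; apply: (@reach_step _ _ _ _ x x x').
  - exact: le_lt_trans zx.
  - exact: Cx'.
  - exact: le_trans zx'.
  - move=> w Cw alw; apply: lex'; split=> //; rewrite leNgt; apply/negP => wz.
    have := le_trans alw (q0P _ Cw wz).
    by rewrite leNgt (lt_le_trans q0q qal).
  - by apply: R => //; apply: le_trans (ltW q1q) qal.
case: H => [|[h1 h2 h3]]; [by left|right]; split=> //.
exact: card_le_trans h3 (below_le (ltW q1q)).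
Qed.

(** Every such [z] has its [g] on the walk from [x] towards the least of them, [z0]. There are
    finitely many such [g], and each accounts only for itself and for the elements of [C g] when
    these number at most [q]. *)
Lemma anchored_card x q l : q <= l -> infinite_set (below l) ->
  [set z | q < z /\ anchored x z q] #<= below l.
Proof.
move=> ql linf; set Z := (X in X #<= _).
have [Z0|N] := pselect (Z !=set0); last first.
  by apply: card_le_empty => z Zz; apply: N; exists z.
have [z0 [[qz0 _] lez0]] := ex_least Z0.
have Rfin : finite_set [set g | reach (fun=> C) z0 x g].
  by apply: reach_finite => // t t' g _ c.
pose F g := g |` [set c | C g c /\ C g #<= below q].
apply: (@card_le_trans _ _ _ (\bigcup_(g in [set g | reach (fun=> C) z0 x g]) F g)).
  apply: subset_card_le => z /[dup] Zz [qz [g [zg R H]]].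
  exists g; first by apply: R; [exact: ltW|exact: lez0].
  by case: H => [->|[h1 h2 h3]]; [left|right; split=> //; exact: C_cl].
apply: card_bigcup_le => //; first exact: finite_le.
move=> g _; apply: card_setU_le => //; first by apply: finite_le => //; exact: finite_set1.
have [Cq|nCq] := pselect (C g #<= below q); last by apply: card_le_empty => c [].
apply: card_le_trans (below_le ql); apply: card_le_trans Cq.
by apply: subset_card_le => c [].
Qed.

End Anchors.

Section Splitting.
Context {d : Order.disp_t} {O : orderType d} {Hwo : well_ordered O}.
Implicit Types (a b c g l q t x y z : O) (A B X S : set O).

Variables (C : O -> set O) (k : O) (P : set O).
Hypothesis C_lt : forall g, C g `<=` below g.
Hypothesis C_cof : forall g al, al < g -> exists2 c, C g c & al <= c.
Hypothesis C_cl : forall g b, b < g -> accumulation (C g) b -> C g b.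
Hypothesis C_card : forall g, C g #<= below (cf g).
Hypothesis C_P : forall g z, g < k -> P z -> z < g -> accumulation (C g) z ->
  forall c, C g c -> cf g <= c.
Hypothesis P_limit : forall z, P z -> limit_ord z.
Hypothesis kinac : inaccessible k.

Variable Pos : set O -> Prop.
Hypothesis Pos_mono : forall A B, A `<=` B -> Pos A -> Pos B.

(** Indecomposability of the family of nonpositive sets, for increasing unions of length [z]. *)
Definition indecomposable z := forall Y : O -> set O,
  (forall q q', q <= q' -> q' < z -> Y q `<=` Y q') ->
  Pos (\bigcup_(q in below z) Y q) -> exists2 q, q < z & Pos (Y q).

(** By indecomposability each [z] in [S] anchors positively many [x] with a single bound, and
    Fodor's lemma makes this bound a constant [q]. An [x] is anchored with bound [q] at few points,
    so among [nu] points its anchors are bounded, and the values of this bound separate positive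
    sets. *)
Lemma positive_splitting S (l0 th : O) : stationary k S -> S `<=` P ->
  (forall z, S z -> indecomposable z) ->
  (forall z, z < k -> Pos [set x | z <= x < k]) ->
  (forall nu, nu < k -> regular nu -> uncountable nu -> l0 < nu -> indecomposable nu) ->
  l0 < k -> infinite_cardinal th -> th < k ->
  exists h : O -> O, (forall y, h y < th) /\ forall i, i < th -> Pos [set x | i < h x].
Proof.
move=> Sst SP Sind Ptail nuind l0k thc thk.
have [kreg kunc klim] := kinac.
have [qf qfP] := @choice O O (fun z q => S z -> q < z /\
    Pos [set x | z <= x < k /\ anchored C x z q]) (fun z =>
    match pselect (S z) with
    | left Sz => let: ex_intro2 q qz Pq := Sind z Sz
        (fun q => [set x | z <= x < k /\ anchored C x z q])
        (fun q q' qq' _ x '(conj h1 h2) => conj h1 (anchored_mono qq' h2))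
        (@Pos_mono [set x | z <= x < k] _ (fun x zxk => let: conj zx xk := andP zxk in
           let: ex_intro2 q qz aq :=
             anchored_ex C_lt C_cof C_card C_P P_limit (SP _ Sz) zx xk in
           ex_intro2 _ _ q qz (conj zxk aq)) (Ptail _ (proj1 Sst _ Sz))) in
        ex_intro _ q (fun=> conj qz Pq)
    | right nS => ex_intro _ z (fun Sz => False_ind _ (nS Sz))
    end).
have [q qk Z1st] := fodor kreg kunc Sst (fun z Sz => (qfP z Sz).1).
set Z1 := (X in stationary k X) in Z1st.
have Z1P z : Z1 z -> q < z /\ Pos [set x | z <= x < k /\ anchored C x z q].
  by move=> [Sz <-]; exact: qfP.
(* [q <= l] limits the anchors of an [x] to [l] many, [l0 <= l] makes the successor [nu]
   indecomposable, and [th <= l] leaves room for [th] disjoint blocks in it. *)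
pose l := Order.max q (Order.max l0 th).
have lk : l < k by rewrite !gt_max qk l0k thk.
have [ql l0l thl] : [/\ q <= l, l0 <= l & th <= l] by rewrite !le_max !lexx !orbT.
have linf : infinite_set (below l).
  by apply: sub_infinite_set thc.2; exact: below_sub.
have [nu [/andP[lnu nuk] nureg nuunc nul]] := limit_cardinal_successor klim lk linf.
have nulim := regular_limit nureg.
(* [phi] lists [nu] points [z] with the same bound [q], and [V x] bounds the [j] for
   which [x] is anchored at [phi j].  The sets [j < V x <= J j] are positive, and
   disjoint for closure points [j] of [J]. *)
have [phi [phiZ phiinj]] := card_leE k
  (card_le_trans (below_le (ltW nuk)) (stationary_card kreg Z1st)).
have [V VP] := @choice O O
  (fun x v => v < nu /\ forall j, j < nu -> anchored C x (phi j) q -> j < v)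
  (fun x => let: ex_intro2 v vnu vP := @regular_bounded_below _ O _ _ nureg _
      [set j | j < nu /\ anchored C x (phi j) q] id l lnu
      (card_le_trans
        (@card_leI _ _ [set j | j < nu /\ anchored C x (phi j) q]
           [set z | q < z /\ anchored C x z q] phi
           (fun j '(conj jnu aj) => conj (proj1 (Z1P _ (phiZ _ jnu))) aj)
           (fun i j '(conj inu _) '(conj jnu _) => phiinj i j inu jnu))
        (anchored_card C_lt C_cof C_cl x ql linf))
      (fun j '(conj jnu _) => jnu) in
    ex_intro _ v (conj vnu (fun j jnu aj => vP j (conj jnu aj)))).
have PV j : j < nu -> Pos [set x | j < V x].
  move=> jnu; apply: Pos_mono (Z1P _ (phiZ _ jnu)).2 => x [_ aj] /=.
  exact: (VP x).2.
have [J JP] := @choice O O (fun j j' => j < nu -> j' < nu /\ Pos [set x | j < V x <= j'])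
  (fun j => match pselect (j < nu) with
    | left jnu => let: ex_intro2 j' j'nu Pj := nuind _ nuk nureg nuunc (le_lt_trans l0l lnu)
        (fun j' => [set x | j < V x <= j'])
        (fun a b ab _ x jV => let: conj h1 h2 := andP jV in
           introT andP (conj h1 (le_trans h2 ab)))
        (@Pos_mono [set x | j < V x] _ (fun x jV => ex_intro2 _ _ (V x) (VP x).1
           (introT andP (conj jV (lexx _)))) (PV j jnu)) in
        ex_intro _ j' (fun=> conj j'nu Pj)
    | right njnu => ex_intro _ j (fun jnu => False_ind _ (njnu jnu))
    end).
have Kc := @club_closure_points _ _ Hwo _ nureg nuunc J (fun j jnu => (JP j jnu).1).
set K := (X in club nu X) in Kc.
have [b bnu Kb] := sub_below_eq Kc.1.1.
(* The club [K] of the regular [nu] has size [nu], hence more than [l] elements. *)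
have thb : th <= b.
  rewrite leNgt; apply/negP => bth; apply: nul.
  have {1}<- : cf nu = nu by case: nureg.
  apply: card_le_trans (cf_min Kc.1) _; apply: card_le_trans (card_eqW Kb) _.
  by apply: below_le; exact: le_trans (ltW bth) thl.
have [psi [psiK psiinj]] := card_leE k (card_le_trans (below_le thb) (card_eqV Kb)).
have [i0 i0th] := infinite_setN0 thc.2.
(* [h x] is the index [j] of the block from [psi j] to [J (psi j)] that contains [V x], with default
   [i0]. *)
have [h hP] := @choice O O (fun x i => i < th /\
    forall j, j < th -> psi j < V x <= J (psi j) -> i = j) (fun x =>
    match pselect (exists j, j < th /\ psi j < V x <= J (psi j)) with
    | left (ex_intro i (conj ith iV)) => ex_intro _ i (conj ith (fun j jth jV =>
        match wo_tot (psi i) (psi j) with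
        | Or31 ij => False_ind _ (elimF idP (ltxx (V x)) (
             let: conj _ iV2 := andP iV in let: conj jV1 _ := andP jV in
             le_lt_trans iV2 (lt_trans (let: And3 _ _ H := psiK j jth in H _ ij) jV1)))
        | Or32 e => psiinj i j ith jth e
        | Or33 ji => False_ind _ (elimF idP (ltxx (V x)) (
             let: conj _ jV2 := andP jV in let: conj iV1 _ := andP iV in
             le_lt_trans jV2 (lt_trans (let: And3 _ _ H := psiK i ith in H _ ji) iV1)))
        end))
    | right N => ex_intro _ i0 (conj i0th (fun j jth jV =>
        False_ind _ (N (ex_intro _ j (conj jth jV)))))
    end).
exists h; split=> [y|i ith]; first by have [] := hP y.
have [j /andP[ij jth]] := (infinite_cardinal_limit thc).2 _ ith.
have [_ Pj] := JP _ (Kc.1.1 _ (psiK _ jth)).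
apply: Pos_mono Pj => x jV /=.
by have [_ H] := hP x; rewrite (H _ jth jV).
Qed.

End Splitting.

(** * C-sequences *)

Section CSequences.
Context {d : Order.disp_t} {O : orderType d} {Hwo : well_ordered O}.
Implicit Types (a b c g l m q t x y z : O) (A B C G S X : set O).

Lemma club_sub_tail g G b : limit_ord g -> club g G -> b < g ->
  club g (G `&` [set x | b < x < g]).
Proof.
move=> gl Gc bg; split; last first.
  move=> z zg acz; split.
    by apply: Gc.2 => //; apply: accumulation_sub acz => x [].
  by apply: (club_tail gl bg).2 => //; apply: accumulation_sub acz => x [].
split=> [x [_ /andP[]]//|x xg].
have [_ /(_ (Order.max b x))[|y Gy]] := club_accumulation gl Gc.
  by rewrite gt_max bg.
rewrite gt_max => /andP[/andP[byy xy] yg].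
by exists y; [split=> //=; rewrite byy|exact: ltW].
Qed.

(** Closing a cofinal subset of [G] of size at most [cf g] adds no more than [cf g] points. *)
Lemma club_refine g G : limit_ord g -> club g G ->
  exists C, [/\ C `<=` G, club g C & C #<= below (cf g)].
Proof.
move=> gl Gc; have [[A [Ag Ac] Acf] _] := cf_least g.
have [f fP] := @choice O O (fun a c => a < g -> G c /\ a < c < g) (fun a =>
  match pselect (a < g) with
  | left ag => let: ex_intro2 c Gac ac := (club_accumulation gl Gc).2 a ag in
      ex_intro _ c (fun=> conj Gac ac)
  | right nag => ex_intro _ a (fun ag => False_ind _ (nag ag))
  end).
pose B := f @` A.
have Bcof x : x < g -> exists2 b, B b & x < b < g.
  move=> /Ac[a Aa xa]; exists (f a); first by exists a.
  have [_ /andP[af ->]] := fP _ (Ag _ Aa); by rewrite (le_lt_trans xa af).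
have BG : B `<=` G by move=> _ [a /Ag /fP[? _] <-].
(* An accumulation point [y] of [B] is determined by [min (B \ y)]. *)
exists [set y | y < g /\ (B y \/ accumulation B y)]; split.
- move=> y [yg [/BG //|acy]]; apply: Gc.2 => //; exact: accumulation_sub acy.
- split; first split.
  + by move=> y [].
  + by move=> x /Bcof[b Bb /andP[xb bg]]; exists b; [split=> //; left|exact: ltW].
  + move=> z zg [z0 zP]; split=> //; right; split=> // x xz.
    have [y [yg [By|[_ yP]]] /andP[xy yz]] := zP _ xz; first by exists y; rewrite ?xy.
    by have [w Bw /andP[xw wy]] := yP _ xy; exists w; rewrite // xw (lt_trans wy).
- have cfinf := @limit_cf_infinite _ _ Hwo _ gl.
  have Bcf : B #<= below (cf g).
    by apply: (@card_le_trans _ _ _ A); [exact: card_image_le|exact: card_eqW].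
  apply: (@card_le_trans _ _ _ (B `|` [set y | y < g /\ accumulation B y])).
    by apply: subset_card_le => y [yg [By|acy]]; [left|right].
  apply: card_setU_le => //; apply: card_le_trans _ Bcf.
  have [s sP] := @choice O O (fun y b => y < g -> (B b /\ y <= b) /\
      forall b', B b' -> y <= b' -> b <= b') (fun y =>
    match pselect (y < g) with
    | left yg => let: ex_intro2 b Bb yb := Bcof y yg in
        let: ex_intro b (conj Bb leb) := @ex_least _ O _ [set b | B b /\ y <= b]
          (ex_intro _ b (conj Bb (let: conj h _ := andP yb in ltW h))) in
        ex_intro _ b (fun=> conj Bb (fun b' Bb' yb' => leb b' (conj Bb' yb')))
    | right nyg => ex_intro _ y (fun yg => False_ind _ (nyg yg))
    end).
  have smono y y' : y' < g -> accumulation B y' -> y < y' -> s y < s y'.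
    move=> y'g [_ acy'] yy'; have [b Bb /andP[yb by']] := acy' _ yy'.
    have [_ H] := sP _ (lt_trans yy' y'g); have [[_ H'] _] := sP _ y'g.
    by apply: le_lt_trans (H _ Bb (ltW yb)) _; exact: lt_le_trans H'.
  apply: (card_leI (f := s)) => [y [yg _]|y y' [yg ay] [y'g ay'] e].
    by have [[]] := sP _ yg.
  case: (ltgtP y y') => // yy'.
    by have := smono _ _ y'g ay' yy'; rewrite e ltxx.
  by have := smono _ _ yg ay yy'; rewrite e ltxx.
Qed.

(** [Q] prescribes a guiding club at limits only. At a successor a one-point set serves, and at the
    least element the empty set; neither has accumulation points, so the last clause holds for every
    [g < k]. *)
Lemma C_sequence k (Q : O -> set O -> Prop) :
  (forall g, limit_ord g -> g < k -> exists2 G, club g G & Q g G) ->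
  exists C : O -> set O, [/\ forall g, C g `<=` below g,
    forall g al, al < g -> exists2 c, C g c & al <= c,
    forall g b, b < g -> accumulation (C g) b -> C g b,
    forall g, C g #<= below (cf g) &
    forall g z, g < k -> z < g -> accumulation (C g) z ->
      limit_ord g /\ exists2 G, Q g G & C g `<=` G].
Proof.
move=> GQ.
have [|C CP] := @choice O (set O) (fun g C => [/\ C `<=` below g,
    forall al, al < g -> exists2 c, C c & al <= c,
    forall b, b < g -> accumulation C b -> C b,
    C #<= below (cf g) &
    forall z, g < k -> z < g -> accumulation C z ->
      limit_ord g /\ exists2 G, Q g G & C `<=` G]); last first.
  by exists C; split=> g; have [] := CP g.
move=> g; have [gl|ngl] := pselect (limit_ord g).
  have [G Gc GQg] : exists2 G, club g G & (g < k -> Q g G).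
    have [gk|ngk] := pselect (g < k).
      by have [G] := GQ g gl gk; exists G.
    by have [x xg] := gl.1; exists [set y | x < y < g]; first exact: club_tail.
  have [C [CG [[Cg Cc] Ccl] Ccf]] := club_refine gl Gc.
  by exists C; split=> // z gk _ _; split=> //; exists G => //; exact: GQg.
have [[x0 x0g]|g0] := pselect (below g !=set0); last first.
  have ng x : ~ (x < g) by move=> xg; apply: g0; exists x.
  by exists set0; split=> [x []|al /ng|b /ng||z _ /ng] //; apply: card_le_empty => x [].
have [p pg pP] : exists2 p, p < g & forall y, y < g -> y <= p.
  apply: contrapT => N; apply: ngl; split; first by exists x0.
  move=> x xg; apply: contrapT => N2; apply: N; exists x => // y yg.
  by rewrite leNgt; apply/negP => xy; apply: N2; exists y; rewrite xy.
have nac z : z < g -> ~ accumulation [set p] z.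
  by move=> /pP zp [[w wz] /(_ _ wz)[y -> /andP[_ ]]]; rewrite ltNge zp.
exists [set p]; split.
- by move=> _ ->.
- by move=> al /pP; exists p.
- by move=> b /nac.
- have [[A [Ag Ac] Acf] _] := cf_least g.
  have [a Aa _] := Ac _ pg.
  apply: (@card_le_trans _ _ _ A); last exact: card_eqW.
  by apply: (card_leI (f := fun=> a)) => // x y -> ->.
- by move=> z _ /nac.
Qed.

End CSequences.

(** * Uncountable limit cardinals below an inaccessible *)

Section LimitCardinals.
Context {d : Order.disp_t} {O : orderType d} {Hwo : well_ordered O}.
Implicit Types (a b c g l m q t x y z : O) (A B C G S X : set O).

Definition unc_limit_card : set O := [set x | uncountable x /\ limit_cardinal x].

Lemma unc_limit_card_limit x : unc_limit_card x -> limit_ord x.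
Proof.
move=> [xunc [xc _]]; apply: infinite_cardinal_limit; split=> // xf.
exact/xunc/finite_set_countable.
Qed.

Lemma unc_limit_card_regular x : unc_limit_card x -> cf x = x -> inaccessible x.
Proof.
move=> /[dup] /unc_limit_card_limit xl [xunc xlim] xcf.
by split=> //; exact: limit_regular.
Qed.

(** The club consists of the points above [w] closed under a function that sends [m] to an
    uncountable cardinal of size greater than [m]. *)
Lemma unc_limit_card_club k w : inaccessible k -> w < k -> infinite_set (below w) ->
  exists2 E, club k E & E `<=` unc_limit_card.
Proof.
move=> [kreg kunc klim] wk winf.
have kl := @regular_limit _ _ Hwo _ kreg.
have mwk m : m < k -> Order.max m w < k by rewrite gt_max => ->.
have [|f fP] := @choice O O (fun m nu => m < k ->
   [/\ Order.max m w < nu, nu < k, cardinal nu, uncountable nu &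
     ~ (below nu #<= below (Order.max m w))]).
  move=> m; have [mk|] := pselect (m < k); last by exists m.
  have minf : infinite_set (below (Order.max m w)).
    apply: contra_not winf; apply: sub_finite_set; apply: below_sub.
    by rewrite le_max lexx orbT.
  have [nu [/andP[a b] [[c _] _] e g]] := limit_cardinal_successor klim (mwk m mk) minf.
  by exists nu.
have fk m : m < k -> f m < k by case/fP.
exists ([set x | [/\ x < k, below x !=set0 & forall m, m < x -> f m < x]] `&`
        [set x | w < x < k]).
  by apply: (clubI kreg kunc); [exact: club_closure_points|exact: (club_tail kl wk)].
move=> x [[xk _ fx] /andP[wx _]]; split.
  have [_ _ _ unc _] := fP _ wk; apply: contra_not unc => xc.
  by apply: card_le_trans xc; apply: below_le; apply/ltW/fx.
have step m : m < x -> exists nu, [/\ m < nu < x, cardinal nu &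
    ~ (below nu #<= below m)].
  move=> mx; have [a b c _ e] := fP _ (lt_trans mx xk); exists (f m); split=> //.
    by rewrite fx // andbT (le_lt_trans _ a)// le_max lexx.
  by apply: contra_not e => H; apply: card_le_trans H _; apply: below_le; rewrite le_max lexx.
split.
  move=> b bx xb; have [nu [/andP[_ nux] _]] := step _ bx; apply.
  by apply: card_le_trans xb; apply: below_le; exact: ltW.
by move=> l _ /step[nu [? ? _]]; exists nu.
Qed.

(** If [g] is uncountable, some cardinal [l < g] has no cardinal strictly between itself and [g],
    and the tail above [l] serves. If [g] is countable, nothing below it is uncountable. *)
Lemma guide_not_inaccessible g : limit_ord g -> cf g = g -> ~ inaccessible g ->
  exists2 G, club g G & forall z, unc_limit_card z -> z < g -> ~ accumulation G z.
Proof.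
move=> gl gcf ng.
have [[gc _] _] := limit_regular gl gcf.
have [x0 x0g] := gl.1.
have [gcount|gunc] := pselect (countable (below g)).
  exists [set x | x0 < x < g]; first exact: club_tail.
  move=> z [zunc _] zg _; apply: zunc; apply: card_le_trans gcount.
  by apply: below_le; exact: ltW.
have [l lc [lg N]] : exists2 l, cardinal l & l < g /\
    forall m, cardinal m -> ~ (l < m < g).
  apply: contrapT => N; apply: ng; split=> //; first exact: limit_regular.
  split=> // l lc lg; apply: contrapT => N2; apply: N; exists l => //; split=> // m mc lm.
  by apply: N2; exists m.
exists [set x | l < x < g]; first exact: club_tail.
move=> z [_ [zc _]] zg [[x xz] /(_ _ xz)[y /andP[ly _] /andP[_ yz]]].
by apply: (N _ zc); rewrite zg (lt_trans ly yz).
Qed.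

End LimitCardinals.

(** * Nonaccumulating C-sequences *)

Section Families.
Context {d : Order.disp_t} {O : orderType d} {Hwo : well_ordered O}.
Implicit Types (c g l m q t x y z : O) (B C G S X : set O).

(** Otherwise each member of [A] has an element below [y], and by disjointness these elements inject
    [A] into [below y]. *)
Lemma family_above k (A : set (set O)) y : cardinal k -> y < k ->
  A #= below k -> trivIset A id -> exists2 b : set O, A b & forall x, b x -> y <= x.
Proof.
move=> kc yk Ak Atriv; apply: contrapT => N.
have H (b : set O) : A b -> exists x, b x /\ x < y.
  move=> Ab; apply: contrapT => N2; apply: N; exists b => // x bx.
  by rewrite leNgt; apply/negP => xy; apply: N2; exists x.
have [|f fP] := @choice (set O) O (fun (b : set O) x => A b -> b x /\ x < y).
  by move=> b; have [/H[x]|] := pselect (A b); [exists x|exists y].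
apply: (kc _ yk); apply: (card_le_trans (card_eqV Ak)).
apply: (card_leI (f := f)) => [b /fP[]//|b b' Ab Ab' e].
have [fb _] := fP _ Ab; have [fb' _] := fP _ Ab'.
by apply: (Atriv _ _ Ab Ab'); exists (f b); split=> //=; rewrite e.
Qed.

(** Beyond [z] the diagonal intersection is contained in each club with index below [z]. *)
Lemma clubs_below k z (Q : O -> set O -> Prop) : regular k -> uncountable k -> z < k ->
  (forall q, q < z -> exists2 E, club k E & Q q E) ->
  exists2 E, club k E & forall q, q < z -> exists2 E', Q q E' & E `<=` E'.
Proof.
move=> kreg kunc zk HQ.
have kl := @regular_limit _ _ Hwo _ kreg.
have [|E EP] := @choice O (set O) (fun q E => club k E /\ (q < z -> Q q E)).
  move=> q; have [/HQ[E]|nq] := pselect (q < z); first by exists E.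
  by exists [set x | z < x < k]; split=> //; exact: club_tail.
exists ([set x | [/\ x < k, below x !=set0 & forall i, i < x -> E i x]] `&`
        [set x | z < x < k]).
  apply: (clubI kreg kunc); last exact: club_tail.
  by apply: (club_diag kreg kunc) => i _; case: (EP i).
move=> q qz; exists (E q); first exact: (EP q).2.
by move=> x [[_ _ H] /andP[zx _]]; apply: H; exact: lt_trans zx.
Qed.

(** Positive means having a stationary trace on [S], so limits [z < k] are indecomposable. As no
    [C g] accumulates at a point [y] of [S], the only possible anchor for [y] is [y] itself, and
    walks pass through it. *)
Lemma U_of_nonaccumulating k chi S : inaccessible k -> infinite_cardinal chi -> chi < k ->
  stationary k S -> (forall z, S z -> limit_ord z) -> (forall z, S z -> chi <= cf z) ->
  (forall g, limit_ord g -> g < k ->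
     exists2 G, club g G & forall z, S z -> z < g -> ~ accumulation G z) ->
  forall th, infinite_cardinal th -> th < k -> U k k th chi.
Proof.
move=> kinac [chic chiinf] chik Sst Slim Scf HG th thinf thk.
have [kreg kunc klim] := kinac.
have [C [C_lt C_cof C_cl C_card CG]] := @C_sequence _ _ Hwo k _ HG.
have nac g z : g < k -> S z -> z < g -> ~ accumulation (C g) z.
  move=> gk Sz zg acz; have [_ [G GS CsG]] := CG _ _ gk zg acz.
  by apply: (GS _ Sz zg); apply: accumulation_sub acz.
have C_P g z : g < k -> S z -> z < g -> accumulation (C g) z ->
    forall c, C g c -> cf g <= c.
  by move=> gk Sz zg /(nac _ _ gk Sz zg).
pose Pos (Y : set O) := forall E, club k E -> exists y, [/\ S y, Y y & E y].
have Pos_mono A B : A `<=` B -> Pos A -> Pos B.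
  by move=> AB HA E /HA[y [Sy /AB By Ey]]; exists y.
have indec z : z < k -> limit_ord z -> indecomposable Pos z.
  move=> zk zl Y _ PY; apply: contrapT => N.
  have [q qz|E Ec EP] := @clubs_below k z (fun q E => forall y, S y -> Y q y -> ~ E y)
      kreg kunc zk.
    apply: contrapT => N2; apply: N; exists q => // E Ec.
    apply: contrapT => N3; apply: N2; exists E => // y Sy Yy Ey.
    by apply: N3; exists y.
  have [y [Sy [q qz Yq] Ey]] := PY _ Ec.
  by have [E' H /(_ _ Ey)] := EP _ qz; exact: H.
have [||||h [h_lt hP]] := @positive_splitting _ _ Hwo C k S C_lt C_cof C_cl C_card C_P Slim kinac
    Pos Pos_mono S chi th Sst _ _ _ _ chik thinf thk.

- by [].
- by move=> z Sz; apply: indec; [exact: Sst.1|exact: Slim].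
- move=> z zk E Ec.
  have [y [Sy [Ey /andP[zy yk]]]] := Sst.2 _ (clubI kreg kunc Ec
    (club_tail (regular_limit kreg) zk)).
  by exists y; split=> //=; rewrite (ltW zy).
- move=> nu nuk nureg _ _; apply: indec => //; exact: regular_limit.
apply: (@U_of_hits _ _ Hwo (fun=> C) _ _ _ h th _ h_lt k chi) => //.
- by move=> *; exact: subset_refl.
- exact: infinite_cardinal_limit.
move=> chi' _ A Asub Ak Atriv i ith E Ec.
have [y [Sy iy Ey]] := hP i ith E Ec.
have yk := Sst.1 _ Sy.
have [b Ab yb] := family_above kreg.1.1 yk Ak Atriv.
exists y, b; split=> //; [exact: Scf|split=> // x bx].
have xk : x < k by apply: (Asub _ Ab).1.
have [q qy [g [yg gP gy]]] := anchored_ex C_lt C_cof C_card C_P Slim Sy (yb _ bx) xk.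
exists q => // al qal aly.
case: gy => [gy|[yg' acy _]]; last first.
  have gk : g < k by apply: (le_lt_trans (reach_le _ (gP q (lexx q) (ltW qy)))).
  by case: (nac _ _ gk Sy yg').
by rewrite -gy; apply: gP; exact: ltW.
Qed.

End Families.

(** * Hulls *)

Section Pigeonhole.
Context {d : Order.disp_t} {O : orderType d} {Hwo : well_ordered O}.
Implicit Types (a c g l m q t x y z : O) (A B C D G S X : set O).

(** If [cf z < cf g], the values of [f] on a short cofinal subset of [z] are bounded. If
    [cf g < cf z] and no [e] worked, [f] would eventually exceed each member of a short cofinal
    subset of [g], hence all of them at one common point. *)
Lemma cofinal_pigeonhole z g (f : O -> O) : cf z <> cf g ->
  (forall q, q < z -> f q < g) ->
  exists2 e, e < g & forall q, q < z -> exists q', [/\ q <= q', q' < z & f q' <= e].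
Proof.
move=> zg fg.
have [[A [Az Ac] Acf] _] := @cf_least _ _ Hwo z.
have [[D [Dg Dc] Dcf] _] := @cf_least _ _ Hwo g.
have cfc := @cf_cardinal _ _ Hwo.
case: (ltgtP (cf z) (cf g)) => // h.
  have [||e eg He] := @fun_bounded _ _ Hwo _ A f g.
  - by move=> x /Az /fg.
  - by apply: (cardinal_not_le (cfc g) h) => //; exact: card_eqW.
  exists e => // q /Ac[q' Aq' qq']; exists q'; split=> //; first exact: Az.
  exact/ltW/He.
apply: contrapT => N.
have [|b bP] := @choice O O (fun e b => e < g -> b < z /\
    forall q, b <= q -> q < z -> e < f q).
  move=> e; have [eg|] := pselect (e < g); last by exists e.
  apply: contrapT => N2; apply: N; exists e => // q qz.
  apply: contrapT => N3; apply: N2; exists q => _; split=> // q' qq' q'z.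
  by rewrite ltNge; apply/negP => ?; apply: N3; exists q'.
have [||c cz Hc] := @fun_bounded _ _ Hwo _ D b z.
- by move=> x /Dg /bP[].
- by apply: (cardinal_not_le (cfc z) h) => //; exact: card_eqW.
have [e De fe] := Dc _ (fg _ cz).
have [_ H] := bP _ (Dg _ De).
by have := H _ (ltW (Hc _ De)) cz; rewrite ltNge fe.
Qed.

Lemma antitone_stable (f : nat -> O) : (forall n, f n.+1 <= f n) ->
  exists N, forall n, (N <= n)%N -> f n = f N.
Proof.
move=> fS.
have fanti (m n : nat) : (m <= n)%N -> f n <= f m.
  elim: n => [|n IH]; first by rewrite leqn0 => /eqP ->.
  rewrite leq_eqVlt => /predU1P[-> //|]; rewrite ltnS => /IH.
  exact: le_trans.
have [_ [[N _ <-] fN]] := @ex_least _ O Hwo (range f) (ex_intro _ _ (imageT f 0%N)).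
by exists N => n Nn; apply/eqP; rewrite eq_le fanti//=; apply: fN; exists n.
Qed.

End Pigeonhole.

Section Hulls.
Context {d : Order.disp_t} {O : orderType d} {Hwo : well_ordered O}.
Implicit Types (a c g l m q t x y z : O) (A B D E G X : set O).

Definition is_floor D q x := [/\ D x, x <= q & forall y, D y -> y <= q -> y <= x].

Lemma is_floor_uniq D q x y : is_floor D q x -> is_floor D q y -> x = y.
Proof.
by move=> [Dx xq Hx] [Dy yq Hy]; apply/eqP; rewrite eq_le Hx ?Hy.
Qed.

Lemma is_floor_ex k D q w : club k D -> q < k -> D w -> w <= q -> exists x, is_floor D q x.
Proof.
move=> [_ Dcl] qk Dw wq.
have [|u [uP umin]] := @ex_least _ O Hwo [set u | forall y, D y -> y <= q -> y <= u].
  by exists q.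
have uq : u <= q by exact: umin.
have wu := uP _ Dw wq.
have [Du|nDu] := pselect (D u); first by exists u.
have ltu y : D y -> y <= u -> y < u.
  by move=> Dy; rewrite le_eqVlt => /predU1P[yu|//]; case: nDu; rewrite -yu.
exists u; split=> //; apply: Dcl; first exact: le_lt_trans qk.
split; first by exists w; exact: ltu.
move=> x xu; apply: contrapT => N.
suff /umin : forall y, D y -> y <= q -> y <= x by rewrite leNgt xu.
move=> y Dy yq; rewrite leNgt; apply/negP => xy; apply: N.
by exists y; rewrite // xy ltu// uP.
Qed.

Variables (C : O -> set O).

(* Floors in [D] of elements of [C x] are added only for those [x] with [C x] of
   size at most [t], which keeps the hull of that size. *)
Inductive hull D t B : O -> Prop :=
| hull_base x of B x : hull D t B x
| hull_floor x q y of hull D t B x & C x #<= below t & C x q & is_floor D q y :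
    hull D t B y.

Lemma hull_sub D t t' B B' : t <= t' -> B `<=` hull D t' B' -> hull D t B `<=` hull D t' B'.
Proof.
move=> tt' BB' x; elim=> [y /BB' //|{}x q y _ Hx Cx Cq qy].
by apply: hull_floor Cq qy => //; exact: card_le_trans (below_le tt').
Qed.

Hypothesis C_lt : forall g, C g `<=` below g.

Lemma hull_le D t z x : hull D t [set z] x -> x = z \/ (D x /\ x < z).
Proof.
elim=> [y -> |{}x q y _ Hx _ /C_lt qx [Dy yq _]]; first by left.
right; split=> //; apply: (le_lt_trans yq); apply: (lt_le_trans qx).
by case: Hx => [->|[_ /ltW]].
Qed.

Lemma hull_empty D t B : (forall x, ~ x < t) -> hull D t B `<=` B.
Proof.
move=> t0 x; elim=> // {}x q y _ _ Cx Cq _; exfalso.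
have [f [fP _]] := card_leE q Cx.
by apply: (t0 (f q)); exact: fP.
Qed.

(** The hull is a union of countably many stages, each adding at most [t] floors for each of at most
    [t] elements. *)
Lemma hull_card D t B : infinite_set (below t) -> B #<= below t -> hull D t B #<= below t.
Proof.
move=> tinf Bt.
pose next x := [set y | C x #<= below t /\ exists2 q, C x q & is_floor D q y].
pose level := fix level n := if n is n.+1 then level n `|` \bigcup_(x in level n) next x else B.
have lev_card n : level n #<= below t.
  elim: n => [//|n IH] /=; apply: card_setU_le => //.
  apply: card_bigcup_le => // x _.
  have [Cx|nCx] := pselect (C x #<= below t); last by apply: card_le_empty => y [].
  apply: card_le_trans Cx; apply: (card_leS (g := fun q => xget q (is_floor D q))).
  move=> y [_ [q Cq qy]]; exists q => //.
  by apply: (is_floor_uniq _ qy); exact: (xgetPex q (ex_intro _ y qy)).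
apply: (@card_le_trans _ _ _ (\bigcup_(n in [set: nat]) level n)).
  apply: subset_card_le => x; elim=> [y By|{}x q y _ [n _ Hx] Cx Cq qy].
    by exists 0%N.
  by exists n.+1 => //; right; exists x => //; split=> //; exists q.
by apply: card_bigcup_le => //; exact: countable_le.
Qed.

End Hulls.

(** * Club guessing along hulls *)

Section Reflecting.
Context {d : Order.disp_t} {O : orderType d} {Hwo : well_ordered O}.
Implicit Types (a c g l m q t x y z : O) (A B D E G X : set O).
Variables (C : O -> set O) (k lam : O) (S0 : set O).
Hypothesis C_lt : forall g, C g `<=` below g.
Hypothesis C_cof : forall g al, al < g -> exists2 c, C g c & al <= c.
Hypothesis C_cl : forall g b, b < g -> accumulation (C g) b -> C g b.
Hypothesis C_card : forall g, C g #<= below (cf g).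
Hypothesis kinac : inaccessible k.
Hypothesis S0_st : stationary k S0.
Hypothesis S0_limit : forall z, S0 z -> limit_ord z.
Hypothesis S0_cf : forall z, S0 z -> cf z = lam.
Hypothesis lam_lt : forall z, S0 z -> lam < z.
Hypothesis lam_unc : ~ countable (below lam).

Let kreg : regular k. Proof. by case: kinac. Qed.
Let kunc : uncountable k. Proof. by case: kinac. Qed.
Let klim : limit_cardinal k. Proof. by case: kinac. Qed.

Lemma below_infinite t : lam <= t -> infinite_set (below t).
Proof.
move=> lt; apply: contra_not lam_unc => tf.
apply: finite_set_countable; apply: sub_finite_set tf; exact: below_sub.
Qed.

(* By [guess_hit] such a [y] is visited from every [x] that is anchored at [z] with
   bound [t]. *)
Definition guess D (e : O -> O) y := exists z t,
  [/\ S0 z, e z <= t, lam <= t & [/\ hull C D t [set z] y, t < y, y < z &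
    ~ (C y #<= below t)]].

(** Club guessing as a notion of positivity. The regressive [e] is arbitrary, so that the bounds of
    anchored walks can be fed in later. *)
Definition guessed D Y := forall e : O -> O, (forall z, S0 z -> e z < z) ->
  forall E, club k E -> exists y, [/\ Y y, E y & guess D e y].

Lemma guess_cf D e y : guess D e y -> lam <= cf y.
Proof.
move=> [z [t [_ _ lt [_ _ _ Cy]]]]; apply: (le_trans lt); rewrite leNgt; apply/negP => yt.
by apply: Cy; apply: (card_le_trans (C_card y)); apply: below_le; exact: ltW.
Qed.

Lemma guessed_sub D A B : A `<=` B -> guessed D A -> guessed D B.
Proof. by move=> AB HA e eS E Ec; have [y [/AB]] := HA e eS E Ec; exists y. Qed.

Lemma guessed_tail D z : guessed D setT -> z < k -> guessed D [set x | z <= x < k].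
Proof.
move=> HD zk e eS E Ec.
have [y [_ [Ey /andP[zy yk]] gy]] := HD e eS _ (clubI kreg kunc Ec
  (club_tail (regular_limit kreg) zk)).
by exists y; split=> //=; rewrite (ltW zy).
Qed.

(** Let [e q] refute [Y q]. As [cf z] differs from [lam = cf x], some [e' x] bounds [e q x] for
    cofinally many [q]. A guess for [e'] in [Y q] is then a guess for [e q'] in [Y q'], for a
    suitable [q' >= q]. *)
Lemma guessed_indecomposable D z : z < k -> cf z <> lam -> indecomposable (guessed D) z.
Proof.
move=> zk zlam Y Ymono PY; apply: contrapT => N.
have [|e eP] := @choice O (O -> O) (fun q e => q < z -> (forall x, S0 x -> e x < x) /\
    exists2 E, club k E & forall y, Y q y -> guess D e y -> ~ E y).
  move=> q; have [qz|] := pselect (q < z); last by exists id.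
  apply: contrapT => N2; apply: N; exists q => // e eS E Ec.
  apply: contrapT => N3; apply: N2; exists e => _; split=> //; exists E => // y Yy gy Ey.
  by apply: N3; exists y.
have [q /eP[_ //]|E Ec EP] := @clubs_below _ _ Hwo k z
    (fun q E => forall y, Y q y -> guess D (e q) y -> ~ E y) kreg kunc zk.
have [|e' e'P] := @choice O O (fun x e' => S0 x -> e' < x /\
    forall q, q < z -> exists q', [/\ q <= q', q' < z & e q' x <= e']).
  move=> x; have [Sx|] := pselect (S0 x); last by exists x.
  have [||e' e'x He'] := @cofinal_pigeonhole _ _ Hwo z x (fun q => e q x).
  - by rewrite (S0_cf Sx).
  - by move=> q /eP[eS _]; exact: eS.
  by exists e'.
have [|y [[q qz Yq] Ey [x [t [Sx et lt H]]]]] := PY e' _ E Ec.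
  by move=> x /e'P[].
have [q' [qq' q'z eq']] := (e'P _ Sx).2 _ qz.
have [E' HE' /(_ _ Ey) E'y] := EP _ q'z.
apply: (HE' y) => //; first exact: (Ymono q q').
by exists x, t; split=> //; exact: le_trans et.
Qed.

(** The enlarged sets along which the final walks run; [g] joins the base because the anchored point
    [z] may be [g] itself. *)
Definition hull_step D t g := hull C D t (g |` C g) `&` below g.

(** At the least level no inhabited [C x] is small enough to contribute floors, so [hull_step] is
    just [C] there. *)
Lemma reach_hull_step D al x g : reach (fun=> C) al x g -> reach (hull_step D) al x g.
Proof.
have [o [_ omin]] : exists o, [set: O] o /\ forall x, [set: O] x -> o <= x.
  by apply: ex_least; exists k.
have stepE y : hull_step D o y = C y.
  apply/seteqP; split=> [w [Hw wy]|w Cw]; last by split; [apply: hull_base; right|exact: C_lt].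
  have [|wy'|//] := hull_empty _ Hw.
    by move=> v; rewrite ltNge omin.
  by move: wy; rewrite /below /= wy' ltxx.
elim=> [y|t y z w aly Cz alz zmin _ IH]; first exact: reach_refl.
by apply: (@reach_step _ _ _ _ o y z) => //; rewrite stepE.
Qed.

(** Once the walk along [C] is at [g], one step at level [t] leads to [y]: the hull at [g] contains
    [z], hence [y], and its part below [y] is bounded in [y], since the hull has size at most [t]
    and [cf y] is larger. *)
Lemma guess_hit D x z t y : S0 z -> lam <= t -> t < y -> y < z ->
  hull C D t [set z] y -> ~ (C y #<= below t) -> anchored C x z t ->
  exists2 e, e < y & forall al, e < al -> al < y -> reach (hull_step D) al x y.
Proof.
move=> Sz lt ty yz Hy Cy [g [zg xg gz]].
have tinf := below_infinite lt.
have Cg : C g #<= below t.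
  case: gz => [->|[_ _ //]]; apply: (card_le_trans (C_card z)).
  by rewrite (S0_cf Sz); exact: below_le.
have zB : (g |` C g) z.
  by case: gz => [->|[zg' acz _]]; [left|right; exact: C_cl].
have [||b b_y Hb] := @not_cofinal_bounded _ _ Hwo y (hull C D t (g |` C g) `&` below y).
- by move=> w [].
- move=> H; apply: Cy; apply: (card_le_trans (C_card y)); apply: (card_le_trans H).
  apply: (@card_le_trans _ _ _ (hull C D t (g |` C g))).
    by apply: subset_card_le => w [].
  apply: hull_card => //; apply: card_setU_le => //.
  by apply: finite_le => //; exact: finite_set1.
exists (Order.max b t); first by rewrite gt_max b_y.
move=> al; rewrite gt_max => /andP[bal tal] aly.
have alz := lt_trans aly yz.
have yg := lt_le_trans yz zg.
have := xg al (ltW tal) (ltW alz) => /(reach_hull_step D) H.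
apply: reach_trans H _.
apply: (@reach_step _ _ _ _ t g y) => //; [exact: lt_trans aly yg| |exact: ltW| |].
- by split=> //; apply: hull_sub Hy => // w ->; exact: hull_base.
- move=> w [Hw wg] alw; rewrite leNgt; apply/negP => wy.
  by have := lt_trans (Hb w (conj Hw wy)) bal; rewrite ltNge alw.
- exact: reach_refl.
Qed.

(** Otherwise every [D] is refuted by some [e0 D] and [E0 D]; starting from a tail of [k], intersect
    countably often with these clubs. *)
Lemma guessed_ex : exists D, guessed D setT.
Proof.
apply: contrapT => N.
have [|e0 e0P] := @choice (set O) (O -> O) (fun D e => (forall x, S0 x -> e x < x) /\
    exists2 E, club k E & forall y, E y -> ~ guess D e y).
  move=> D; apply: contrapT => N2; apply: N; exists D => e eS E Ec.
  apply: contrapT => N3; apply: N2; exists e; split=> //; exists E => // y Ey gy.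
  by apply: N3; exists y.
have [E0 E0P] := @choice (set O) (set O) (fun D E => club k E /\
  forall y, E y -> ~ guess D (e0 D) y)
  (fun D => let: ex_intro2 E Ec EP := (e0P D).2 in ex_intro _ E (conj Ec EP)).
have kl := @regular_limit _ _ Hwo _ kreg.
have [lx [lxk lamlx]] : exists x, x < k /\ lam < x.
  have [x0 x0k] := kl.1.
  have [x [Sx _]] := S0_st.2 _ (club_tail kl x0k).
  by exists x; split; [exact: S0_st.1|exact: lam_lt].
have lamk := lt_trans lamlx lxk.
(* The floors in the decreasing clubs [D n] of a given ordinal stabilise.  Hence the
   elements of [Dw] just below a suitable [z] in [S0] lie in the late hulls of [z],
   unless one of these contains some [y] that [D n.+1] was chosen to avoid. *)
pose D := fix D n := if n is n.+1 then D n `&` E0 (D n) else [set x | lam < x < k].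
have Dc n : club k (D n).
  elim: n => [|n IH]; first exact: club_tail.
  by apply: (clubI kreg kunc) => //; case: (E0P (D n)).
have DS (m n : nat) : (m <= n)%N -> D n `<=` D m.
  elim: n => [|n IH]; first by rewrite leqn0 => /eqP ->.
  rewrite leq_eqVlt => /predU1P[-> //|]; rewrite ltnS => /IH Dnm x [/Dnm //].
pose Dw := [set x | x < k /\ forall n, D n x].
have Dwc : club k Dw by exact: (club_bigcap_nat kreg kunc).
(* More than [m] points of [Dw] lie between [m] and [p]. The contradiction will be that hulls of
   size [t] cover those between [t] and [p t]. *)
have [|p pP] := @choice O O (fun m p => m < k -> p < k /\
    ~ (Dw `&` [set x | m < x <= p] #<= below m)).
  move=> m; have [mk|] := pselect (m < k); last by exists m.
  have mlk : Order.max m lam < k by rewrite gt_max mk.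
  have mlinf : infinite_set (below (Order.max m lam)).
    by apply: below_infinite; rewrite le_max lexx orbT.
  have [nu [/andP[_ nuk] nureg _ nuN]] := limit_cardinal_successor klim mlk
    mlinf.
  have [Xcof _] := clubI kreg kunc Dwc (club_tail kl mk).
  have := @cf_min _ _ Hwo _ _ Xcof; rewrite kreg.2 => kX; have [j [jX jinj]] := card_leE k kX.
  have [|p pk jp] := @regular_bounded_below _ _ Hwo k kreg _ (below nu) j nu nuk
      (card_lexx _).
    by move=> i /= inu; have [_ /andP[]] := jX _ (lt_trans inu nuk).
  exists p => _; split=> //; apply: contra_not nuN => H.
  apply: (@card_le_trans _ _ _ (below m)); last by apply: below_le; rewrite le_max lexx.
  apply: (card_le_trans _ H); apply: (card_leI (f := j)) => [i inu|i i' inu i'nu].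
    have [Dwj /andP[mj _]] := jX _ (lt_trans inu nuk).
    by split=> //=; rewrite mj; exact/ltW/jp.
  by apply: jinj; [exact: lt_trans nuk|exact: lt_trans nuk].
have clp := @club_closure_points _ _ Hwo _ kreg kunc p (fun m mk => (pP m mk).1).
have [z [Sz [[zk _ zp] /andP[lamz _]]]] := S0_st.2 _ (clubI kreg kunc clp (club_tail kl lamk)).
(* As [cf z = lam] is uncountable, one [e] bounds countably many values. *)
have [||e ez He] := @fun_bounded _ _ Hwo nat setT (fun n => e0 (D n) z) z.
- by move=> n _; apply: (e0P (D n)).1.
- by rewrite (S0_cf Sz).
pose t := Order.max e lam.
have lt : lam <= t by rewrite le_max lexx orbT.
have tz : t < z by rewrite gt_max ez lamz.
have tinf := below_infinite lt.
have [pk Np] := pP _ (lt_trans tz zk).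
have pz := zp _ tz.
pose ev y := exists N0, forall n, (N0 <= n)%N -> hull C (D n) t [set z] y.
apply: Np; apply: (@card_le_trans _ _ _
  (\bigcup_(n in [set: nat]) hull C (D n) t [set z])); last first.
  apply: card_bigcup_le => //; first exact: countable_le.
  move=> n _; apply: hull_card => //; apply: finite_le => //; exact: finite_set1.
apply: subset_card_le => w [[wk Dw_w] /andP[tw wp]].
suff [N0 H] : ev w by exists N0 => //; exact: H.
(* The least such [y] turns out to be [w]: otherwise the eventual floor of an element of [C y] that
   is at least [w] would be a smaller candidate. *)
have [|y [[evy yz [wy ty]] ymin]] := @ex_least _ O Hwo
    [set y | [/\ ev y, y <= z & w <= y /\ t < y]].
  exists z; split=> //; first by exists 0%N => n _; exact: hull_base.
  by split=> //; apply/ltW/(le_lt_trans wp).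
have [<- //|wy'] := eqVneq y w.
have {wy' wy} wy : w < y by rewrite lt_neqAle eq_sym wy' wy.
have yk : y < k := le_lt_trans yz zk.
have Cy : C y #<= below t.
  have [->|yz'] := eqVneq y z.
    by apply: (card_le_trans (C_card z)); rewrite (S0_cf Sz); exact: below_le.
  have {}yz : y < z by rewrite lt_neqAle yz' yz.
  (* If [C y] were larger than [t], then [y], being in [D N0.+1], would be a guess for [D N0] inside
     the club [E0 (D N0)]. *)
  apply: contrapT => nCy; have [N0 HN0] := evy.
  have DNy n : (N0 <= n)%N -> D n y.
    by move=> /HN0 /(hull_le C_lt)[e'|[]//]; move: yz; rewrite e' ltxx.
  have [_ /(_ y)] := E0P (D N0).
  have [_ EDy] := DNy _ (leqnSn N0).
  apply=> //; exists z, t; split=> //; last by split=> //; exact: HN0.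
  by rewrite le_max (ltW (He _ _)).
have [q Cq wq] := C_cof wy.
have qy := C_lt Cq.
have [f fP] := @choice nat O (fun n x => is_floor (D n) q x)
  (fun n => is_floor_ex (Dc n) (lt_trans qy yk) (Dw_w n) wq).
have fS n : f n.+1 <= f n.
  have [Df fq _] := fP n.+1; have [_ _ H] := fP n; apply: H => //.
  exact: (DS _ _ (leqnSn n)).
have [N1 HN1] := antitone_stable fS.
have [N0 HN0] := evy.
have [_ fq Hf] := fP N1.
have wf := Hf _ (Dw_w N1) wq.
have : y <= f N1.
  apply: ymin; split; last by split=> //; exact: lt_le_trans tw wf.
    exists (maxn N0 N1) => n; rewrite geq_max => /andP[n0 n1].
    by apply: (hull_floor (HN0 _ n0) Cy Cq); rewrite -(HN1 _ n1).
  by apply: (le_trans fq); apply: (le_trans (ltW qy)).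
by rewrite leNgt (le_lt_trans fq qy).
Qed.

(** The guesses come from [S0], while the splitting runs on [S1], whose cofinalities differ from
    [lam] as [guessed_indecomposable] requires. *)
Lemma U_of_guesses S1 chi th : stationary k S1 -> (forall z, S1 z -> limit_ord z) ->
  (forall z, S1 z -> cf z <> lam) ->
  (forall g z, g < k -> (S0 `|` S1) z -> z < g -> accumulation (C g) z ->
     forall c, C g c -> cf g <= c) ->
  cardinal chi -> chi <= lam -> lam < k -> infinite_cardinal th -> th < k ->
  U k k th chi.
Proof.
move=> S1st S1lim S1cf C_P chic chilam lamk thinf thk.
have P_limit z : (S0 `|` S1) z -> limit_ord z by move=> [/S0_limit|/S1lim].
have [D HD] := guessed_ex.
have [||||h [h_lt hP]] := @positive_splitting _ _ Hwo C k (S0 `|` S1) C_lt C_cof C_cl C_card C_P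
    P_limit kinac (guessed D) (@guessed_sub D) S1 lam th S1st _ _ _ _ lamk thinf thk.
- by move=> z; right.
- by move=> z Sz; apply: guessed_indecomposable; [exact: S1st.1|exact: S1cf].
- by move=> z; exact: guessed_tail.
- move=> nu nuk [_ nucf] _ lamnu; apply: guessed_indecomposable => //.
  by move=> e; move: lamnu; rewrite -e nucf ltxx.
have step_lt t g : hull_step D t g `<=` below g by move=> x [].
apply: (@U_of_hits _ _ Hwo (hull_step D) step_lt _ _ h th _ h_lt k chi) => //.
- move=> t g al /C_cof[c Cc alc]; exists c => //.
  by split; [apply: hull_base; right|exact: C_lt].
- move=> t t' g tt' x [Hx xg]; split=> //; apply: hull_sub Hx => // w; exact: hull_base.
- exact: infinite_cardinal_limit.
- exact: le_lt_trans lamk.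
move=> chi' chi'chi A Asub Ak Atriv i ith E Ec.
(* A member [b] above [z] has fewer than [chi <= lam = cf z] elements, so they are anchored at [z]
   with a common bound; this is the [e] to be guessed against. *)
have [|e eP] := @choice O O (fun z e => S0 z -> e < z /\ exists b : set O,
    [/\ A b, forall x, b x -> z <= x & forall x, b x -> anchored C x z e]).
  move=> z; have [Sz|] := pselect (S0 z); last by exists z.
  have zk := S0_st.1 _ Sz.
  have [b Ab zb] := family_above kreg.1.1 zk Ak Atriv.
  have [|q qP] := @choice O O (fun x q => b x -> q < z /\ anchored C x z q).
    move=> x; have [bx|] := pselect (b x); last by exists z.
    have [|q qz xzq] := anchored_ex C_lt C_cof C_card C_P P_limit _ (zb _ bx)
      ((Asub _ Ab).1 _ bx); first by left.
    by exists q.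
  have [||e ez He] := @fun_bounded _ _ Hwo _ b q z.
  - by move=> x /qP[].
  - rewrite (S0_cf Sz).
    by apply: (cardinal_not_le chic chi'chi chilam); apply: card_eqW; exact: (Asub _ Ab).2.
  exists e => _; split=> //; exists b; split=> // x bx.
  by apply: anchored_mono (qP _ bx).2; exact/ltW/He.
have [|y [hy Ey gy]] := hP i ith e _ E Ec; first by move=> z /eP[].
have cfy := guess_cf gy.
have [z [t [Sz et lt [Hy ty yz Cy]]]] := gy.
have [_ [b [Ab zb Hb]]] := eP _ Sz.
exists y, b; split=> //; first exact: le_trans cfy.
split=> // x bx; first by apply: le_trans (zb _ bx); exact: ltW.
by apply: (guess_hit Sz lt ty yz Hy Cy); apply: anchored_mono (Hb _ bx).
Qed.

End Reflecting.

(** * Reflection *)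

Section Dichotomy.
Context {d : Order.disp_t} {O : orderType d} {Hwo : well_ordered O}.
Implicit Types (a c g k l m q t x y z : O) (A B C D E G S T X : set O).

Lemma club_restrict g G z : club g G -> z < g -> accumulation G z -> club z (G `&` below z).
Proof.
move=> [_ Gcl] zg [_ acz]; split; first split.
- by move=> x [].
- by move=> x /acz[y Gy /andP[xy yz]]; exists y; [split|exact: ltW].
move=> b bz acb; split=> //; apply: Gcl; first exact: lt_trans zg.
by apply: accumulation_sub acb => x [].
Qed.

Lemma club_accumulations g G : regular g -> uncountable g -> club g G ->
  exists2 E, club g E & forall x, E x -> accumulation G x.
Proof.
move=> greg gunc Gc.
have [|f fP] := @choice O O (fun m c => m < g -> G c /\ m < c < g).
  move=> m; have [mg|] := pselect (m < g); last by exists m.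
  by have [c Gc' mc] := club_next greg Gc mg; exists c.
exists [set x | [/\ x < g, below x !=set0 & forall m, m < x -> f m < x]].
  by apply: club_closure_points => // m /fP[_ /andP[]].
move=> x [xg x0 xf]; split=> // m mx; have [Gf /andP[mf _]] := fP _ (lt_trans mx xg).
by exists (f m); rewrite // mf xf.
Qed.

(** Hence limit points of cofinality at least [cf z] do not form a stationary subset of [z]. *)
Lemma thin_club z : limit_ord z ->
  exists2 G, club z G & forall y, G y -> limit_ord y -> cf y < cf z.
Proof.
move=> zl; have [[A [Az Ac] Acf] _] := @cf_least _ _ Hwo z.
have [f [fA fsurj]] : exists f : O -> O, (forall i, i < cf z -> A (f i)) /\
    forall a, A a -> exists2 i, i < cf z & f i = a.
  have [x0 x0z] := zl.1; have [a0 Aa0 _] := Ac _ x0z.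
  have [r [rA rinj]] := card_leE z (card_eqW Acf).
  have [|f fP] := @choice O O (fun i a => A a /\ forall a', A a' -> r a' = i -> a' = a).
    move=> i; have [[a [Aa ai]]|N] := pselect (exists a, A a /\ r a = i).
      by exists a; split=> // a' Aa' a'i; apply: rinj => //; rewrite ai.
    by exists a0; split=> // a' Aa' a'i; case: N; exists a'.
  exists f; split=> [i _|a Aa]; first exact: (fP i).1.
  by exists (r a); [exact: rA|rewrite -((fP (r a)).2 a)].
(* The records of an enumeration [f] of a cofinal set in type [cf z] can only pile up
   at points of smaller cofinality; passing to their successors removes the limits
   among the records themselves. *)
pose rec i := i < cf z /\ forall j, j < i -> f j < f i.
have recP x : x < z -> exists i, [/\ rec i, x <= f i & forall j, j < i -> f j < x].
  move=> xz; have [|i [[iz xi] imin]] := @ex_least _ O Hwo [set i | i < cf z /\ x <= f i].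
    by have [a /fsurj[i iz <-] xa] := Ac _ xz; exists i.
  have H j : j < i -> f j < x.
    move=> ji; rewrite ltNge; apply/negP => xj.
    by have := imin j (conj (lt_trans ji iz) xj); rewrite leNgt ji.
  by exists i; split=> //; split=> // j /H /lt_le_trans; apply.
pose A' := [set x | exists2 i, rec i & f i = x].
have A'_cf y : y < z -> accumulation A' y -> cf y < cf z.
  (* Records below [y] have indices below this [i], so [cf y] is at most the size of [i < cf z]. *)
  move=> yz [_ acy]; have [i [[iz _] yi Hi]] := recP _ yz.
  rewrite ltNge; apply/negP => zy; apply: (cf_cardinal iz).
  apply: (card_le_trans (below_le zy)).
  apply: (@card_le_trans _ _ _ (A' `&` below y)).
    apply: cf_min; split=> [x []//|x /acy[a A'a /andP[xa ay]]].
    by exists a; [|exact: ltW].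
  apply: (card_leS (g := f)) => _ [[j [jz Hj] <-] jy]; exists j => //.
  case: (ltgtP j i) => // [ij|ji].
    by have := lt_trans (Hj _ ij) jy; rewrite ltNge yi.
  by move: jy; rewrite ji /below /= ltNge yi.
have [|s sP] := @choice O O (fun a s => a < z -> [/\ a < s, s < z & forall x, a < x -> s <= x]).
  move=> a; have [az|] := pselect (a < z); last by exists a.
  have [b /andP[ab bz]] := zl.2 _ az.
  have [|s [as_ smin]] := @ex_least _ O Hwo [set s | a < s]; first by exists b.
  by exists s => _; split=> //; apply: le_lt_trans bz; exact: smin.
have A'z a : A' a -> a < z by move=> [i [iz _] <-]; apply/Az/fA.
exists [set x | x < z /\ ((exists2 a, A' a & s a = x) \/ accumulation A' x)].
  split; first split.
  - by move=> x [].
  - move=> x xz; have [i [ri xi _]] := recP _ xz.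
    have A'i : A' (f i) by exists i.
    have [is_ sz _] := sP _ (A'z _ A'i).
    exists (s (f i)); first by split=> //; left; exists (f i).
    by apply: (le_trans xi); exact: ltW.
  - move=> b bz [b0 acb]; split=> //; right; split=> // x xb.
    have [y _ /andP[xy yb]] := acb _ xb.
    have [y' [_ [[a A'a <-]|[_ acy']]] /andP[yy' y'b]] := acb _ yb.
      have [as_ _ smin] := sP _ (A'z _ A'a).
      exists a => //; rewrite (lt_trans as_ y'b) andbT (lt_le_trans xy)// leNgt.
      by apply/negP => /smin; rewrite leNgt yy'.
    have [a A'a /andP[ya ay']] := acy' _ yy'.
    by exists a => //; rewrite (lt_trans xy)// (lt_trans ay').
move=> y [yz [[a A'a <-]|/(A'_cf _ yz)//]] [_ H].
have [as_ _ smin] := sP _ (A'z _ A'a).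
have [x /andP[/smin ax]] := H _ as_; by rewrite ltNge ax.
Qed.

Definition nonreflecting k T := forall g, inaccessible g -> g < k ->
  exists2 G, club g G & forall z, T z -> ~ G z.

Definition reflection k T := [set z | [/\ z < k, unc_limit_card z & stationary z (T `&` below z)]].

Lemma not_stationary_club g T : ~ stationary g (T `&` below g) ->
  exists2 G, club g G & forall z, T z -> ~ G z.
Proof.
move=> nst; have [|G Gc GT] := not_stationary _ nst; first by move=> x [].
by exists G => // z Tz Gz; apply: (GT z) => //; split=> //; exact: Gc.1.1.
Qed.

Lemma reflection_singular k T z : nonreflecting k T -> reflection k T z -> cf z < z.
Proof.
move=> NT [zk zK [_ zst]]; have := @cf_le _ _ Hwo z; rewrite le_eqVlt => /predU1P[zcf|//].
have [G Gc GT] := NT _ (unc_limit_card_regular zK zcf) zk.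
by have [x [[/GT]]] := zst _ Gc.
Qed.

Lemma reflection_cf k T z l : T `<=` unc_limit_card -> (forall y, T y -> cf y = l) ->
  reflection k T z -> cf z <> l.
Proof.
move=> TK Tl [zk zK [_ zst]] zl.
have [G Gc Gcf] := thin_club (unc_limit_card_limit zK).
have [x [[Tx _] Gx]] := zst _ Gc.
have xl : limit_ord x by apply: unc_limit_card_limit; exact: TK.
by have := Gcf _ Gx xl; rewrite zl (Tl _ Tx) ltxx.
Qed.

Lemma club_reflection g G k T z : club g G -> (forall x, T x -> ~ G x) ->
  reflection k T z -> z < g -> ~ accumulation G z.
Proof.
move=> Gc GT [zk zK [_ zst]] zg acz.
by have [x [[Tx _] [Gx _]]] := zst _ (club_restrict Gc zg acz); exact: GT Gx.
Qed.

(** A club avoiding [T] does not accumulate at reflection points of [T], so the club of its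
    accumulation points avoids them. *)
Lemma nonreflecting_reflection k T : nonreflecting k T -> nonreflecting k (reflection k T).
Proof.
move=> NT g ginac gk; have [G Gc GT] := NT g ginac gk.
have [greg gunc _] := ginac.
have [E Ec EG] := club_accumulations greg gunc Gc.
exists E => // z Rz Ez; apply: (club_reflection Gc GT Rz); last exact: EG.
exact: Ec.1.1.
Qed.

(** At a singular [g] a thin club above [cf g] is a suitable guide: an accumulation point [z] of it
    has [cf z < cf g < z], so it is not regular. *)
Lemma U_of_regulars k chi S : inaccessible k -> infinite_cardinal chi -> chi < k ->
  stationary k S -> S `<=` unc_limit_card -> (forall z, S z -> chi <= cf z /\ cf z = z) ->
  nonreflecting k S ->
  forall th, infinite_cardinal th -> th < k -> U k k th chi.
Proof.
move=> kinac chiinf chik Sst SK Scf NS.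
apply: (@U_of_nonaccumulating _ _ Hwo k chi S) => //.
- by move=> z /SK /unc_limit_card_limit.
- by move=> z /Scf[].
move=> g gl gk; have := @cf_le _ _ Hwo g; rewrite le_eqVlt => /predU1P[gcf|gcf].
  have [ginac|ng] := pselect (inaccessible g).
    have [G Gc GS] := NS g ginac gk; exists G => // z Sz zg acz.
    exact: (GS z Sz (Gc.2 _ zg acz)).
  have [G Gc GK] := guide_not_inaccessible gl gcf ng.
  by exists G => // z /SK /GK.
have [G Gc Gcf] := thin_club gl.
exists (G `&` [set x | cf g < x < g]); first exact: club_sub_tail.
move=> z Sz zg acz.
have [Gz /andP[gz _]] := (club_sub_tail gl Gc gcf).2 _ zg acz.
have := Gcf _ Gz (accumulation_limit acz); rewrite (Scf _ Sz).2 => /lt_trans /(_ gz).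
by rewrite ltxx.
Qed.

(** Let a club [E] avoid the reflection points. For [g] in [E] some club of [g] avoids [T]; for [g]
    outside [E] some tail of [g] avoids [E]. So the guides do not accumulate in the intersection of
    [T] and [E]. *)
Lemma U_of_nonstationary_reflection k chi T : inaccessible k ->
  infinite_cardinal chi -> chi < k ->
  stationary k T -> T `<=` unc_limit_card -> (forall z, T z -> chi <= cf z) ->
  ~ stationary k (reflection k T) ->
  forall th, infinite_cardinal th -> th < k -> U k k th chi.
Proof.
move=> kinac chiinf chik Tst TK Tcf nst.
have [kreg kunc _] := kinac.
have [|E1 E1c E1R] := not_stationary _ nst; first by move=> x [].
have [E2 E2c E2K] := unc_limit_card_club kinac chik chiinf.2.
have [] : club k (E1 `&` E2) /\ E1 `&` E2 `<=` unc_limit_card.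
  by split; [exact: clubI|move=> x [_ /E2K]].
move: (E1 `&` E2) (fun x (h : (E1 `&` E2) x) => E1R x ^~ h.1).
move=> E ER Ec EK.
apply: (@U_of_nonaccumulating _ _ Hwo k chi (T `&` E)) => //.
- exact: stationaryI.
- by move=> z [/TK /unc_limit_card_limit].
- by move=> z [/Tcf].
move=> g gl gk; have [Eg|nEg] := pselect (E g).
  have [|G Gc GT] := @not_stationary_club g T.
    by move=> gst; apply: (ER g Eg); split=> //; exact: EK.
  by exists G => // z [Tz _] zg acz; apply: (GT z Tz); exact: Gc.2.
have [x xg Hx] : exists2 x, x < g & forall y, E y -> ~ (x < y < g).
  apply: contrapT => N; apply: nEg; apply: Ec.2 => //; split; first exact: gl.1.
  move=> x xg; apply: contrapT => N2; apply: N; exists x => // y Ey xy.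
  by apply: N2; exists y.
exists [set y | x < y < g]; first exact: club_tail.
move=> z [_ Ez] zg [[y0 /[dup] y0z _] /(_ _ y0z)[y /andP[xy _] /andP[_ yz]]].
by apply: (Hx z Ez); rewrite zg (lt_trans xy yz).
Qed.

(** At a singular [g] the guide starts above [cf g], which is enough for anchoring; at a regular [g]
    it accumulates neither in [T] nor at its reflection points. The latter have cofinality other
    than [lam] and serve for the splitting, [T] for the guesses. *)
Lemma U_of_stationary_reflection k chi T lam : inaccessible k ->
  infinite_cardinal chi -> chi <= lam -> ~ countable (below lam) ->
  stationary k T -> T `<=` unc_limit_card -> (forall z, T z -> cf z = lam /\ lam < z) ->
  nonreflecting k T -> stationary k (reflection k T) ->
  forall th, infinite_cardinal th -> th < k -> U k k th chi.
Proof.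
move=> kinac [chic _] chilam lamunc Tst TK Tcf NT Rst th thinf thk.
have [kreg kunc _] := kinac.
pose P := T `|` reflection k T.
have PK : P `<=` unc_limit_card by move=> z [/TK//|[]].
have [|C [C_lt C_cof C_cl C_card CG]] := @C_sequence _ _ Hwo k
    (fun g G => forall z, P z -> z < g -> accumulation G z -> forall c, G c -> cf g <= c).
  move=> g gl gk; have := @cf_le _ _ Hwo g; rewrite le_eqVlt => /predU1P[gcf|gcf]; last first.
    by exists [set x | cf g < x < g]; [exact: club_tail|move=> z _ _ _ c /andP[/ltW]].
  have [ginac|ng] := pselect (inaccessible g).
    have [G Gc GT] := NT g ginac gk; exists G => // z [Tz|Rz] zg acz.
      by case: (GT z Tz); exact: Gc.2.
    by case: (club_reflection Gc GT Rz zg acz).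
  have [G Gc GK] := guide_not_inaccessible gl gcf ng.
  by exists G => // z /PK /GK H /H.
have lamk : lam < k.
  have [x0 x0k] := (regular_limit kreg).1.
  have [x Tx /andP[_ xk]] := stationary_next kreg Tst x0k.
  exact: lt_trans (Tcf _ Tx).2 xk.
apply: (@U_of_guesses _ _ Hwo C k lam T C_lt C_cof C_cl C_card kinac Tst _ _ _ lamunc
  (reflection k T)) => //.
- by move=> z /TK /unc_limit_card_limit.
- by move=> z /Tcf[].
- by move=> z /Tcf[].
- by move=> z [_ /unc_limit_card_limit].
- by move=> z; apply: reflection_cf => // y /Tcf[].
move=> g z gk Pz zg acz c Cc; have [_ [G GP CsG]] := CG _ _ gk zg acz.
apply: (GP z) => //; [exact: accumulation_sub acz|exact: CsG].
Qed.

End Dichotomy.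

(** * Case distinction by regularity, reflection and cofinality *)

Theorem theoremC (d : Order.disp_t) (O : orderType d)
    (O_wo : well_order (<=%O : rel O))
    (kappa chi : O)
    (kappa_inaccessible : inaccessible kappa)
    (chi_infinite : infinite_cardinal chi)
    (chi_lt_kappa : (chi < kappa)%O)
    (S_ex : exists S : set O,
        [/\ stationary kappa S,
            subset S (E_ge kappa chi)
          & no_inaccessible_reflection kappa S]) :
  forall theta : O, infinite_cardinal theta -> (theta < kappa)%O ->
    U kappa kappa theta chi.
Proof.
have Hwo : well_ordered O := O_wo.
have [S [Sst SE Snr]] := S_ex.
have [kreg kunc _] := kappa_inaccessible.
have [E Ec EK] := unc_limit_card_club kappa_inaccessible chi_lt_kappa chi_infinite.2.
have NS : nonreflecting kappa S.
  move=> g ginac gk; apply: not_stationary_club => gst.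
  by apply: Snr; exists g.
have sub T : T `<=` S -> nonreflecting kappa T.
  by move=> TS g ginac gk; have [G Gc GS] := NS g ginac gk; exists G => // z /TS /GS.
have [regst|singst] := stationaryU kreg kunc (fun x => cf x = x) (stationaryI kreg kunc Sst Ec).
  apply: (U_of_regulars kappa_inaccessible chi_infinite chi_lt_kappa regst).
  - by move=> x [[_ /EK]].
  - by move=> x [[/SE[]]].
  - by apply: sub => x [[]].
(* On singular points [cf] is regressive, hence constant on a stationary [T]. *)
have [|lam lamk] := fodor kreg kunc (f := cf) singst.
  by move=> x [_ xcf]; rewrite lt_neqAle cf_le andbT; exact/eqP.
set T := (X in stationary _ X) => Tst.
have TK : T `<=` unc_limit_card by move=> x [[[_ /EK]]].
have Tcf x : T x -> cf x = lam /\ lam < x.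
  by move=> [[_ xcf] <-]; split=> //; rewrite lt_neqAle cf_le andbT; exact/eqP.
have NT : nonreflecting kappa T by apply: sub => x [[[]]].
have chilam : chi <= lam.
  by have [x [Tx _]] := Tst.2 _ Ec; rewrite -(Tcf _ Tx).1; have [[[/SE[]]]] := Tx.
have [Rst|nRst] := pselect (stationary kappa (reflection kappa T)); last first.
  apply: (U_of_nonstationary_reflection kappa_inaccessible chi_infinite chi_lt_kappa Tst) => //.
  by move=> z /Tcf[->].
have [lamcount|lamunc] := pselect (countable (below lam)); last first.
  exact: (U_of_stationary_reflection kappa_inaccessible chi_infinite chilam lamunc Tst).
(* For countable [lam], pass to the reflection points of [T], which are singular too; fixing their
   cofinality gives [T']. *)
have [|lam' lam'k] := fodor kreg kunc (f := cf) Rst.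
  by move=> x; exact: reflection_singular.
set T' := (X in stationary _ X) => T'st.
have T'R : T' `<=` reflection kappa T by move=> x [].
have T'K : T' `<=` unc_limit_card by move=> x [[]].
have T'cf x : T' x -> cf x = lam' /\ lam' < x.
  by move=> [Rx <-]; split=> //; exact: reflection_singular Rx.
have NT' : nonreflecting kappa T'.
  move=> g ginac gk; have [G Gc GR] := nonreflecting_reflection NT ginac gk.
  by exists G => // z /T'R /GR.
(* [lam] and [lam'] are distinct infinite cardinals, and at most one infinite cardinal is
   countable. *)
have lam'unc : ~ countable (below lam').
  have [x [Tx _]] := Tst.2 _ Ec; have [y [T'y _]] := T'st.2 _ Ec.
  have xl : limit_ord x by exact: unc_limit_card_limit (TK _ Tx).
  have yl : limit_ord y by exact: unc_limit_card_limit (T'K _ T'y).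
  have : cf y <> lam.
    by apply: reflection_cf TK _ (T'R _ T'y) => z /Tcf[].
  move: (@cf_cardinal _ _ Hwo x) (@cf_cardinal _ _ Hwo y)
    (@limit_cf_infinite _ _ Hwo _ xl) (@limit_cf_infinite _ _ Hwo _ yl).
  rewrite (Tcf _ Tx).1 (T'cf _ T'y).1 => xc yc xinf yinf lamN lam'count.
  case: (ltgtP lam lam') => // h; [apply: (yc _ h)|apply: (xc _ h)|by case: lamN].
  - exact: countable_le.
  - exact: countable_le.
have chilam' : chi <= lam'.
  apply: (le_trans chilam); rewrite leNgt; apply/negP => lam'lam.
  by apply: lam'unc; apply: card_le_trans lamcount; apply: below_le; exact: ltW.
have [R'st|nR'st] := pselect (stationary kappa (reflection kappa T')).
  exact: (U_of_stationary_reflection kappa_inaccessible chi_infinite chilam' lam'unc T'st).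
apply: (U_of_nonstationary_reflection kappa_inaccessible chi_infinite chi_lt_kappa T'st) => //.
by move=> z /T'cf[->].
Qed.
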